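(* Let $A=b\mathcal{O}G$, $A'=b'\mathcal{O}G'$, $B=b\mathcal{O}N$, $B'=b'\mathcal{O}N'$ be as in the context, and assume that $A$ and $A'$ are $\bar G$-graded algebras over a $\bar G$-graded $\bar G$-acted $\mathcal{O}$-algebra $\mathcal{C}$. Let $\Delta^{\mathcal{C}}=\Delta(A\otimes_{\mathcal{C}}A'^{\mathrm{op}})$. Assume that the $(B,B')$-bimodule $M$ and its $B$-dual $M^*=\mathrm{Hom}_B(M,B)$ induce a Morita equivalence between $B$ and $B'$ (via the functors $M^*\otimes_B-:B\text{-}\mathrm{mod}\to B'\text{-}\mathrm{mod}$ and $M\otimes_{B'}-:B'\text{-}\mathrm{mod}\to B\text{-}\mathrm{mod}$). If $M$ extends to a $\Delta^{\mathcal{C}}$-module, then: (1) $M^*$ becomes a $\Delta(A'\otimes_{\mathcal{C}}A^{\mathrm{op}})$-module; (2) $\tilde M:=(A\otimes_{\mathcal{C}}A'^{\mathrm{op}})\otimes_{\Delta^{\mathcal{C}}}M$ is a $\bar G$-graded $(A,A')$-bimodule over $\mathcal{C}$, its $A$-dual satisfies $\tilde M^*\simeq(A'\otimes_{\mathcal{C}}A^{\mathrm{op}})\otimes_{\Delta(A'\otimes_{\mathcal{C}}A^{\mathrm{op}})}M^*$ as $\bar G$-graded $(A',A)$-bimodules over $\mathcal{C}$, and $\tilde M$ and $\tilde M^*$ induce a $\bar G$-graded Morita equivalence over $\mathcal{C}$ between $A$ and $A'$.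
   Context: Setting. $(\mathcal{K},\mathcal{O},k)$ is a $p$-modular system: $\mathcal{O}$ is a complete discrete valuation ring with field of fractions $\mathcal{K}$ and algebraically closed residue field $k$ of characteristic $p$; $\mathcal{K}$ contains all roots of unity of order $|G|$. $G$ is a finite group, $N\trianglelefteq G$, $G'\le G$ with $G=G'N$, $N'=G'\cap N$, so $\bar G:=G/N\simeq G'/N'$. $b\in Z(\mathcal{O}N)$ and $b'\in Z(\mathcal{O}N')$ are $\bar G$-invariant block idempotents. $A=b\mathcal{O}G$ and $A'=b'\mathcal{O}G'$ are $\bar G$-graded crossed products with $A_{\bar g}=b\mathcal{O}[gN]$, $A'_{\bar g}=b'\mathcal{O}[gN']$ ($g\in G'$), and identity components $B$, $B'$; $u_{\bar g}\in A_{\bar g}$, $u'_{\bar g}\in A'_{\bar g}$ denote invertible homogeneous elements. Algebras over $\mathcal{C}$. A $\bar G$-graded $\bar G$-acted $\mathcal{O}$-algebra is a $\bar G$-graded $\mathcal{O}$-algebra $\mathcal{C}=\bigoplus_{\bar g}\mathcal{C}_{\bar g}$ with a left action of $\bar G$ (by algebra automorphisms) such that ${}^{\bar g}\mathcal{C}_{\bar h}\subseteq\mathcal{C}_{\bar g\bar h\bar g^{-1}}$. Example: $C_A(B)$ with $C_A(B)_{\bar h}=C_A(B)\cap A_{\bar h}$ and ${}^{\bar g}c=u_{\bar g}cu_{\bar g}^{-1}$. $A$ is over $\mathcal{C}$ if it is equipped with a grade-preserving $\bar G$-equivariant algebra homomorphism $\zeta:\mathcal{C}\to C_A(B)$; similarly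 $A'$ with $\zeta':\mathcal{C}\to C_{A'}(B')$. $\mathcal{C}$ acts on modules through $\zeta$, $\zeta'$. Bimodules over $\mathcal{C}$. A $\bar G$-graded $(A,A')$-bimodule over $\mathcal{C}$ is an $(A,A')$-bimodule $\tilde M=\bigoplus_{\bar g}\tilde M_{\bar g}$ with $A_{\bar g}\tilde M_{\bar x}A'_{\bar h}\subseteq\tilde M_{\bar g\bar x\bar h}$ and $\tilde m_{\bar g}\cdot c={}^{\bar g}c\cdot\tilde m_{\bar g}$ for all $c\in\mathcal{C}$, $\tilde m_{\bar g}\in\tilde M_{\bar g}$. Its $A$-dual $\tilde M^*=\mathrm{Hom}_A(\tilde M,A)$ is a $\bar G$-graded $(A',A)$-bimodule over $\mathcal{C}$ via $(a'fa)(m)=f(ma')a$, with $\bar x$-component $\{f\mid f(\tilde M_{\bar g})\subseteq A_{\bar g\bar x}\ \forall\bar g\}$. $\tilde M$ induces a $\bar G$-graded Morita equivalence over $\mathcal{C}$ between $A$ and $A'$ if $\tilde M\otimes_{A'}\tilde M^*\cong A$ as $\bar G$-graded $(A,A)$-bimodules over $\mathcal{C}$ and $\tilde M^*\otimes_A\tilde M\cong A'$ as $\bar G$-graded $(A',A')$-bimodules over $\mathcal{C}$. Diagonal algebras. $A\otimes_{\mathcal{C}}A'^{\mathrm{op}}$ is formed with $ac\otimes a'=a\otimes ca'$ (product $ca'$ in $A'$). $\Delta(A\otimes_{\mathcal{C}}A'^{\mathrm{op}})$ is the $\mathcal{O}$-submodule $\sum_{\bar g}A_{\bar g}\otimes_{\mathcal{C}}A'_{\bar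 g^{-1}}$, an $\mathcal{O}$-algebra with $(a\otimes a')(d\otimes d')=ad\otimes d'a'$ (products on the right in $A$, $A'$); $A\otimes_{\mathcal{C}}A'^{\mathrm{op}}$ is a right module over it by the same formula and a $\bar G$-graded $(A,A')$-bimodule over $\mathcal{C}$ via $x(a\otimes a')y=xa\otimes a'y$, where $a\otimes a'$ with $a\in A_{\bar g},a'\in A'_{\bar h}$ has degree $\bar g\bar h$. $\Delta(A'\otimes_{\mathcal{C}}A^{\mathrm{op}})$ is defined symmetrically. ''$M$ extends to a $\Delta^{\mathcal{C}}$-module'' means $M$ has a $\Delta^{\mathcal{C}}$-module structure with $(x\otimes y)m=xmy$ for $x\in B$, $y\in B'$. The $\Delta(A'\otimes_{\mathcal{C}}A^{\mathrm{op}})$-module structure on $M^*$ extends its $(B',B)$-bimodule structure and is given by $((a'\otimes a)f)(m)=u_{\bar g}\,f\big((u_{\bar g}^{-1}\otimes a')m\big)\,a$ for $a'\in A'_{\bar g}$, $a\in A_{\bar g^{-1}}$. *)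

(* Defs.v *)
From HB Require Import structures.
From mathcomp Require Import all_boot all_order all_fingroup all_algebra.
From mathcomp Require Import boolp functions.
Set Implicit Arguments.
Unset Strict Implicit.
Unset Printing Implicit Defensive.
Import GRing.Theory.
Local Open Scope ring_scope.
Local Open Scope quotient_scope.

Definition adic_lim (O : idomainType) (pi : O) (s : nat -> O) (l : O) : Prop :=
  forall n, exists m, forall i, (m <= i)%N -> exists c, s i - l = pi ^+ n * c.

Definition adic_cauchy (O : idomainType) (pi : O) (s : nat -> O) : Prop :=
  forall n, exists m, forall i j, (m <= i)%N -> (m <= j)%N ->
    exists c, s i - s j = pi ^+ n * c.

Definition complete_dvr (O : idomainType) : Prop :=
  exists pi : O, [/\ pi != 0, pi \isn't a GRing.unit,
    forall x, x != 0 -> exists n, exists2 u, u \is a GRing.unit & x = u * pi ^+ n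
  & forall s, adic_cauchy pi s -> exists l, adic_lim pi s l].

Record p_modular_system (p : nat) (O : idomainType) (K : fieldType)
    (k : closedFieldType) (iota : {rmorphism O -> K})
    (res : {rmorphism O -> k}) : Prop := PModularSystem {
  pms_dvr : complete_dvr O;
  pms_frac_inj : injective iota;
  pms_frac : forall x : K, exists a c, c != 0 /\ x = iota a / iota c;
  pms_res_surj : forall y : k, exists a, res a = y;
  pms_res_ker : forall a, (res a == 0) = (a \isn't a GRing.unit);
  pms_char : p \in [pchar k]
}.

(* Stated as a splitting condition because nothing excludes that [K] has
   characteristic [p]. *)
Definition contains_roots_of_unity (K : fieldType) (n : nat) : Prop :=
  exists s : seq K, 'X^n - 1 = \prod_(z <- s) ('X - z%:P) :> {poly K}.

Definition grpalg (O : comNzRingType) (gT : finGroupType) : Type :=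
  {ffun gT -> O}.

Section GroupAlgebra.
Variables (O : comNzRingType) (gT : finGroupType).
Local Notation OG := (grpalg O gT).
Implicit Types (x y z : OG) (D E : {set gT}).

HB.instance Definition _ := GRing.Lmodule.copy OG {ffun gT -> O^o}.

Definition gcoef x (g : gT) : O := (x : {ffun gT -> O}) g.
Definition gelt (g : gT) : OG := [ffun h => (h == g)%:R].
Definition gmul x y : OG := [ffun g => \sum_h gcoef x h * gcoef y (h^-1 * g)%g].

Lemma gcoefP x y : gcoef x =1 gcoef y -> x = y.
Proof. by move=> e; apply/ffunP. Qed.

Lemma gcoefD x y g : gcoef (x + y) g = gcoef x g + gcoef y g.
Proof. by rewrite /gcoef ffunE. Qed.
Lemma gcoefN x g : gcoef (- x) g = - gcoef x g.
Proof. by rewrite /gcoef ffunE. Qed.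
Lemma gcoef0 g : gcoef 0 g = 0.
Proof. by rewrite /gcoef ffunE. Qed.
Lemma gcoefZ (a : O) x g : gcoef (a *: x) g = a * gcoef x g.
Proof. by rewrite /gcoef ffunE. Qed.
Lemma gcoef_gelt h g : gcoef (gelt h) g = (g == h)%:R.
Proof. by rewrite /gcoef ffunE. Qed.
Lemma gcoef_gmul x y g :
  gcoef (gmul x y) g = \sum_h gcoef x h * gcoef y (h^-1 * g)%g.
Proof. by rewrite {1}/gcoef ffunE. Qed.

Fact gmulA : associative gmul.
Proof.
move=> x y z; apply: gcoefP => g; rewrite !gcoef_gmul.
under [RHS]eq_bigr => k _ do rewrite gcoef_gmul mulr_suml.
rewrite exchange_big; apply: eq_bigr => h _ /=.
rewrite gcoef_gmul mulr_sumr (reindex_inj (mulgI h^-1%g)) /=.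
apply: eq_bigr => k _.
by rewrite mulrA invMg invgK -!mulgA mulKVg.
Qed.

Fact gmul1l : left_id (gelt 1%g) gmul.
Proof.
move=> x; apply: gcoefP => g; rewrite gcoef_gmul (bigD1 1%g) //= big1.
  by rewrite gcoef_gelt eqxx mul1r addr0 invg1 mul1g.
by move=> h nh; rewrite gcoef_gelt (negPf nh) mul0r.
Qed.

Fact gmul1r : right_id (gelt 1%g) gmul.
Proof.
move=> x; apply: gcoefP => g; rewrite gcoef_gmul (bigD1 g) //= big1.
  by rewrite gcoef_gelt mulVg eqxx mulr1 addr0.
move=> h nh; rewrite gcoef_gelt; case: eqP => [e|]; last by rewrite mulr0.
by case/eqP: nh; apply: (mulgI h^-1%g); rewrite e mulVg.
Qed.

Fact gmulDl : left_distributive gmul +%R.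
Proof.
move=> x y z; apply: gcoefP => g; rewrite gcoefD !gcoef_gmul -big_split /=.
by apply: eq_bigr => h _; rewrite gcoefD mulrDl.
Qed.

Fact gmulDr : right_distributive gmul +%R.
Proof.
move=> x y z; apply: gcoefP => g; rewrite gcoefD !gcoef_gmul -big_split /=.
by apply: eq_bigr => h _; rewrite gcoefD mulrDr.
Qed.

Fact gelt1_neq0 : gelt 1%g != 0.
Proof.
apply/eqP => /(congr1 (gcoef^~ 1%g)); rewrite gcoef_gelt gcoef0 eqxx.
by move/eqP; rewrite oner_eq0.
Qed.

HB.instance Definition _ := GRing.Zmodule_isNzRing.Build OG
  gmulA gmul1l gmul1r gmulDl gmulDr gelt1_neq0.

Fact gscalerAl (a : O) x y : a *: (x * y) = (a *: x) * y.
Proof.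
apply: gcoefP => g; rewrite gcoefZ !gcoef_gmul mulr_sumr.
by apply: eq_bigr => h _; rewrite gcoefZ mulrA.
Qed.
HB.instance Definition _ := GRing.Lmodule_isLalgebra.Build O OG gscalerAl.

Fact gscalerAr (a : O) x y : a *: (x * y) = x * (a *: y).
Proof.
apply: gcoefP => g; rewrite gcoefZ !gcoef_gmul mulr_sumr.
by apply: eq_bigr => h _; rewrite gcoefZ mulrCA.
Qed.
HB.instance Definition _ := GRing.Lalgebra_isAlgebra.Build O OG gscalerAr.

Lemma gcoefM x y g : gcoef (x * y) g = \sum_h gcoef x h * gcoef y (h^-1 * g)%g.
Proof. exact: gcoef_gmul. Qed.

Lemma geltM g h : gelt (g * h)%g = gelt g * gelt h.
Proof.
apply: gcoefP => k; rewrite gcoefM (bigD1 g) //= big1 => [|i ni].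
  rewrite !gcoef_gelt eqxx mul1r addr0; congr (_%:R); congr nat_of_bool.
  by apply/eqP/eqP => [->|<-]; rewrite ?mulKg ?mulKVg.
by rewrite gcoef_gelt (negPf ni) mul0r.
Qed.

Lemma gelt1 : gelt 1%g = 1. Proof. by []. Qed.

Lemma grpalg_sum x : x = \sum_g gcoef x g *: gelt g.
Proof.
apply: gcoefP => h.
rewrite (big_morph (gcoef^~ h) (fun y z => gcoefD y z h) (gcoef0 h)).
rewrite (bigD1 h) //= big1 => [|i ni].
  by rewrite gcoefZ gcoef_gelt eqxx mulr1 addr0.
by rewrite gcoefZ gcoef_gelt eq_sym (negPf ni) mulr0.
Qed.

(* For a subgroup [H], the subalgebra [O H] of [O G] consists of the elements
   supported on [H]. *)
Definition supported D : {pred OG} :=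
  [pred x | [forall g, (gcoef x g != 0) ==> (g \in D)]].

Lemma supportedP D x :
  reflect (forall g, g \notin D -> gcoef x g = 0) (x \in supported D).
Proof.
apply: (iffP forallP) => h g.
  by apply: contraNeq => xg; apply: (implyP (h g)).
by apply/implyP; apply: contra_neqT; exact: h.
Qed.

Lemma supported_submod D : submod_closed (supported D).
Proof.
split=> [|a x y /supportedP hx /supportedP hy]; apply/supportedP => g gD.
  exact: gcoef0.
by rewrite gcoefD gcoefZ hx // hy // mulr0 addr0.
Qed.

Lemma supportedM D E x y :
  x \in supported D -> y \in supported E -> x * y \in supported (D * E)%g.
Proof.
move=> /supportedP hx /supportedP hy; apply/supportedP => g gDE.
rewrite gcoefM big1 // => h _.
have [hD|hD] := boolP (h \in D); last by rewrite hx // mul0r.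
rewrite hy ?mulr0 //; apply: contra gDE => hE.
by rewrite -(mulKVg h g) mem_mulg.
Qed.

Lemma supportedS D E : D \subset E -> {subset supported D <= supported E}.
Proof.
move=> sDE x /supportedP hx; apply/supportedP => g gE; apply: hx.
by apply: contra gE; apply: (subsetP sDE).
Qed.

Lemma supportedI D E x :
  x \in supported D -> x \in supported E -> x \in supported (D :&: E).
Proof.
move=> /supportedP hx /supportedP hy; apply/supportedP => g.
by rewrite inE negb_and => /orP [/hx|/hy].
Qed.

Lemma gelt_supported g D : g \in D -> gelt g \in supported D.
Proof.
move=> gD; apply/supportedP => h; rewrite gcoef_gelt.
by case: eqP => // -> /negP.
Qed.

Definition center_grpalg (L : {group gT}) x : Prop :=
  x \in supported L /\ {in supported L, forall y, x * y = y * x}.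

Definition block_idempotent (L : {group gT}) (e : OG) : Prop :=
  [/\ center_grpalg L e, e != 0, e * e = e
    & forall f1 f2, center_grpalg L f1 -> center_grpalg L f2 ->
        f1 * f1 = f1 -> f2 * f2 = f2 -> f1 * f2 = 0 -> e = f1 + f2 ->
        f1 = 0 \/ f2 = 0].

(* Block idempotents of [O L] that are stable under conjugation by the
   overgroup [H] of [L]. *)
Record inv_block (H L : {group gT}) := InvBlock {
  block_idem :> OG;
  block_sub : L \subset H;
  block_idemP : block_idempotent L block_idem;
  block_inv : {in H, forall g, gelt g * block_idem * gelt g^-1%g = block_idem}
}.

Section BlockAlgebra.
Variables (H L : {group gT}) (b : inv_block H L).

Definition block_pred : {pred OG} :=
  [pred x | (x \in supported H) && (block_idem b * x == x)].

Fact block_pred_submod : submod_closed block_pred.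
Proof.
have [s0 sl] := supported_submod H; split; first by rewrite inE s0 mulr0 eqxx.
move=> a x y; rewrite !inE => /andP [hx /eqP bx] /andP [hy /eqP bY].
by rewrite mulrDr -scalerAr bx bY eqxx andbT; apply: sl.
Qed.
HB.instance Definition _ := GRing.isSubmodClosed.Build O OG block_pred
  block_pred_submod.

(* [b O H], whose identity element is [b]; since [b] commutes with [O H], the
   equation [b x = x] describes it. *)
Record blockalg := BlockAlg {
  blockalg_val :> OG;
  blockalg_valP : blockalg_val \in block_pred
}.
HB.instance Definition _ := [isSub for blockalg_val].
HB.instance Definition _ := [Choice of blockalg by <:].
HB.instance Definition _ := [SubChoice_isSubLmodule of blockalg by <:].

Lemma block_idemM : block_idem b * block_idem b = block_idem b.
Proof. by case: (block_idemP b). Qed.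

Lemma block_supp : block_idem b \in supported L.
Proof. by case: (block_idemP b) => [[]]. Qed.

Lemma block_comm x : x \in supported H -> block_idem b * x = x * block_idem b.
Proof.
move=> /supportedP hx; rewrite [x]grpalg_sum mulr_sumr mulr_suml.
apply: eq_bigr => g _; rewrite -scalerAr -scalerAl.
have [gH|/hx ->] := boolP (g \in H); last by rewrite !scale0r.
congr (_ *: _); rewrite -{1}(block_inv b gH) -!mulrA -geltM.
by rewrite mulVg gelt1 mulr1.
Qed.

Lemma blockalg_supp (x : blockalg) : \val x \in supported H.
Proof. by case: x => x /= /andP []. Qed.
Lemma blockalg_mull (x : blockalg) : block_idem b * \val x = \val x.
Proof. by case: x => x /= /andP [_ /eqP]. Qed.
Lemma blockalg_mulr (x : blockalg) : \val x * block_idem b = \val x.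
Proof. by rewrite -block_comm ?blockalg_supp ?blockalg_mull. Qed.

Fact blockalg_one_proof : block_idem b \in block_pred.
Proof.
rewrite inE block_idemM eqxx andbT.
exact: supportedS (block_sub b) _ block_supp.
Qed.
Definition blockalg_one := BlockAlg blockalg_one_proof.

Fact blockalg_mul_proof (x y : blockalg) : \val x * \val y \in block_pred.
Proof.
rewrite inE mulrA blockalg_mull eqxx andbT -[X in supported X]mulGid.
by apply: supportedM; apply: blockalg_supp.
Qed.
Definition blockalg_mul (x y : blockalg) := BlockAlg (blockalg_mul_proof x y).

Fact blockalg_mulA : associative blockalg_mul.
Proof. by move=> x y z; apply: val_inj; rewrite /= mulrA. Qed.
Fact blockalg_mul1l : left_id blockalg_one blockalg_mul.
Proof. by move=> x; apply: val_inj; exact: blockalg_mull. Qed.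
Fact blockalg_mul1r : right_id blockalg_one blockalg_mul.
Proof. by move=> x; apply: val_inj; exact: blockalg_mulr. Qed.
Fact blockalg_mulDl : left_distributive blockalg_mul +%R.
Proof. by move=> x y z; apply: val_inj; rewrite /= mulrDl. Qed.
Fact blockalg_mulDr : right_distributive blockalg_mul +%R.
Proof. by move=> x y z; apply: val_inj; rewrite /= mulrDr. Qed.
Fact blockalg_one_neq0 : blockalg_one != 0.
Proof. by rewrite -(inj_eq val_inj) /=; case: (block_idemP b). Qed.
HB.instance Definition _ := GRing.Zmodule_isNzRing.Build blockalg
  blockalg_mulA blockalg_mul1l blockalg_mul1r blockalg_mulDl blockalg_mulDr
  blockalg_one_neq0.

Fact blockalg_scalerAl (a : O) (x y : blockalg) : a *: (x * y) = (a *: x) * y.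
Proof. by apply: val_inj; rewrite /= scalerAl. Qed.
HB.instance Definition _ :=
  GRing.Lmodule_isLalgebra.Build O blockalg blockalg_scalerAl.
Fact blockalg_scalerAr (a : O) (x y : blockalg) : a *: (x * y) = x * (a *: y).
Proof. by apply: val_inj; rewrite /= scalerAr. Qed.
HB.instance Definition _ :=
  GRing.Lalgebra_isAlgebra.Build O blockalg blockalg_scalerAr.

End BlockAlgebra.
End GroupAlgebra.

Arguments gcoef {O gT} x g.
Arguments gcoef0 {O gT} g.
Arguments inv_block : clear implicits.
Arguments inv_block O {gT} H L.

Section Grading.
Variables (Q : finGroupType) (V : zmodType).

Definition is_decomp (Vg : Q -> {pred V}) (v : V) (f : {ffun Q -> V}) : Prop :=
  (forall g, f g \in Vg g) /\ v = \sum_g f g.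

Definition is_grading (Vg : Q -> {pred V}) : Prop :=
  (forall g, zmod_closed (Vg g)) /\ forall v, exists! f, is_decomp Vg v f.

Variables (Vg : Q -> {pred V}) (gV : is_grading Vg).

Definition gproj (g : Q) (v : V) : V := sval (cid (gV.2 v)) g.

Lemma gproj_mem g v : gproj g v \in Vg g.
Proof. by rewrite /gproj; case: (cid _) => f /= [[hf _] _]. Qed.

Lemma gproj_sum v : v = \sum_g gproj g v.
Proof. by rewrite /gproj; case: (cid _) => f /= [[_ hf] _]. Qed.

Lemma gproj_uniq v (f : {ffun Q -> V}) g : is_decomp Vg v f -> gproj g v = f g.
Proof. by rewrite /gproj; case: (cid _) => f' /= [_ hf] /hf ->. Qed.

Lemma gcomp0 g : 0 \in Vg g. Proof. by case: (gV.1 g). Qed.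
Lemma gcompB g u v : u \in Vg g -> v \in Vg g -> u - v \in Vg g.
Proof. by case: (gV.1 g) => _; apply. Qed.
Lemma gcompN g u : u \in Vg g -> - u \in Vg g.
Proof. by rewrite -[- u]add0r; apply: gcompB; apply: gcomp0. Qed.
Lemma gcompD g u v : u \in Vg g -> v \in Vg g -> u + v \in Vg g.
Proof. by move=> hu hv; rewrite -[v]opprK; apply/gcompB/gcompN. Qed.
Lemma gcomp_sum g (I : Type) (r : seq I) (P : pred I) (F : I -> V) :
  (forall i, P i -> F i \in Vg g) -> \sum_(i <- r | P i) F i \in Vg g.
Proof. by move=> h; elim/big_rec: _ => [|i x /h]; [apply: gcomp0|apply: gcompD]. Qed.

Lemma gprojD g : {morph gproj g : u v / u + v}.
Proof.
move=> u v; rewrite (@gproj_uniq _ [ffun h => gproj h u + gproj h v]) ?ffunE //.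
split=> [h|]; first by rewrite ffunE gcompD ?gproj_mem.
rewrite {1}[u]gproj_sum {1}[v]gproj_sum -big_split /=.
by apply: eq_bigr => h _; rewrite ffunE.
Qed.

Lemma gproj0 g : gproj g 0 = 0.
Proof. by apply: (addrI (gproj g 0)); rewrite -gprojD !addr0. Qed.

Lemma gproj_big g (I : Type) (r : seq I) (P : pred I) (F : I -> V) :
  gproj g (\sum_(i <- r | P i) F i) = \sum_(i <- r | P i) gproj g (F i).
Proof. exact: (big_morph _ (gprojD g) (gproj0 g)). Qed.

Lemma gproj_hom g h v : v \in Vg g -> gproj h v = if h == g then v else 0.
Proof.
move=> vg; rewrite (@gproj_uniq _ [ffun k => if k == g then v else 0]) ?ffunE //.
split=> [k|]; first by rewrite ffunE; case: eqP => [->//|_]; apply: gcomp0.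
rewrite (bigD1 g) //= ffunE eqxx big1 ?addr0 // => k /negPf nk.
by rewrite ffunE nk.
Qed.

End Grading.

Section GradedAlgebras.
Variables (O : comNzRingType) (Q : finGroupType).

Definition is_graded_algebra (A : algType O) (Ag : Q -> {pred A}) : Prop :=
  [/\ is_grading Ag, forall g, submod_closed (Ag g), 1 \in Ag 1%g
    & forall g h x y, x \in Ag g -> y \in Ag h -> x * y \in Ag (g * h)%g].

(* In [cp_unit], [v] is the inverse of the invertible homogeneous element [u]. *)
Record crossed_product := CrossedProduct {
  cp_alg :> algType O;
  cp_comp : Q -> {pred cp_alg};
  cp_graded : is_graded_algebra cp_comp;
  cp_unit : forall g, exists u v,
    [/\ u \in cp_comp g, v \in cp_comp g^-1%g, u * v = 1 & v * u = 1]
}.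

Record graded_acted_algebra := GradedActedAlgebra {
  ga_alg :> algType O;
  ga_comp : Q -> {pred ga_alg};
  ga_graded : is_graded_algebra ga_comp;
  ga_act : Q -> {lrmorphism ga_alg -> ga_alg};
  ga_act1 : forall c, ga_act 1%g c = c;
  ga_actM : forall g h c, ga_act (g * h)%g c = ga_act g (ga_act h c);
  ga_act_comp : forall g h c, c \in ga_comp h ->
    ga_act g c \in ga_comp (g * h * g^-1)%g
}.

Arguments cp_comp : clear implicits.
Arguments cp_unit : clear implicits.
Arguments cp_graded : clear implicits.
Arguments ga_comp : clear implicits.
Arguments ga_act : clear implicits.

(* [zeta] is a grade-preserving equivariant homomorphism into the centralizer
   in [A] of its identity component, on which [g] acts as conjugation by any
   invertible element [u] of degree [g]. *)
Definition is_structure_map (C : graded_acted_algebra) (A : crossed_product)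
    (zeta : C -> A) : Prop :=
  [/\ forall c x, x \in cp_comp A 1%g -> zeta c * x = x * zeta c,
      forall g c, c \in ga_comp C g -> zeta c \in cp_comp A g
    & forall g c u v, u \in cp_comp A g -> u * v = 1 -> v * u = 1 ->
        zeta (ga_act C g c) = u * zeta c * v].

Record cp_over (C : graded_acted_algebra) := CPOver {
  co_alg :> crossed_product;
  co_map : {lrmorphism C -> co_alg};
  co_mapP : is_structure_map co_map
}.

Section IdentityComponent.
Variable A : crossed_product.

Definition idcomp_pred : {pred A} := cp_comp A 1%g.
Fact idcomp_subalg : subalg_closed idcomp_pred.
Proof.
case: (cp_graded A) => _ hZ h1 hM; split=> //; first by case: (hZ 1%g).
by move=> x y hx hy; rewrite /idcomp_pred -[X in cp_comp A X]mulg1 hM.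
Qed.
HB.instance Definition _ := GRing.isSubalgClosed.Build O A idcomp_pred
  idcomp_subalg.

Record idcomp := IdComp {
  idcomp_val :> A;
  idcomp_valP : idcomp_val \in idcomp_pred
}.
HB.instance Definition _ := [isSub for idcomp_val].
HB.instance Definition _ := [Choice of idcomp by <:].
HB.instance Definition _ := [SubChoice_isSubAlgebra of idcomp by <:].

End IdentityComponent.

End GradedAlgebras.

Arguments cp_comp {O Q} _ _.
Arguments cp_unit {O Q} _ _.
Arguments cp_graded {O Q} _.
Arguments ga_comp {O Q} _ _.
Arguments ga_act {O Q} _ _.

Section CrossedProductTheory.
Variables (O : comNzRingType) (Q : finGroupType).
Variable A : crossed_product O Q.

Lemma cp_grading : is_grading (cp_comp A). Proof. by case: (cp_graded A). Qed.
Lemma cp_compM (g h : Q) (x y : A) :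
  x \in cp_comp A g -> y \in cp_comp A h -> x * y \in cp_comp A (g * h)%g.
Proof. by case: (cp_graded A) => _ _ _; apply. Qed.
Lemma cp_comp1 : 1 \in cp_comp A 1%g. Proof. by case: (cp_graded A). Qed.
Lemma cp_compA (k : O) : k%:A \in cp_comp A 1%g.
Proof.
case: (cp_graded A) => _ /(_ 1%g) [h0 hl] h1 _.
by rewrite -[k%:A]addr0; apply: hl.
Qed.

Lemma cp_proj_l k a m g : a \in cp_comp A k ->
  gproj cp_grading g (a * m) = a * gproj cp_grading (k^-1 * g)%g m.
Proof.
move=> ak; rewrite (@gproj_uniq _ _ _ _ _
  [ffun h => a * gproj cp_grading (k^-1 * h)%g m]) ?ffunE //.
split=> [h|].
  by rewrite ffunE -{2}(mulKVg k h) cp_compM // gproj_mem.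
rewrite {1}(gproj_sum cp_grading m) mulr_sumr (reindex_inj (mulgI k^-1%g)) /=.
by apply: eq_bigr => h _; rewrite ffunE.
Qed.

Lemma co_commute (C : graded_acted_algebra O Q) (zeta : {lrmorphism C -> A})
    (g : Q) (x : A) (c : C) :
  is_structure_map zeta -> x \in cp_comp A g ->
  x * zeta c = zeta (ga_act C g c) * x.
Proof.
move=> [hC _ hE] xg; have [u [v [ug vg uv vu]]] := cp_unit A g.
rewrite (hE g c u v ug uv vu) -mulrA.
have vx : v * x \in cp_comp A 1%g by rewrite -(mulVg g) cp_compM.
by rewrite -mulrA hC // !mulrA uv mul1r.
Qed.

End CrossedProductTheory.

Section BlockCrossedProduct.
Variables (O : comNzRingType) (gT : finGroupType) (N H L : {group gT}).
Hypotheses (nN : (N <| [set: gT])%g) (HN : (H * N)%g = [set: gT]) (LN : L \subset N).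
Variable b : inv_block O H L.

(* As [H * N] is the whole group [G], [H / (H :&: N)] is identified with
   [G / N]: the component of degree [x] is [b O [x :&: H]], and the identity
   component is [b O [H :&: N]]. *)
Definition blockalg_comp (x : coset_of N) : {pred blockalg b} :=
  [pred a | \val a \in supported x].

Lemma mem_cosetT g : g \in 'N(N)%g.
Proof. by apply: (subsetP (normal_norm nN)); rewrite inE. Qed.

Lemma mem_coset_of g (x : coset_of N) : (g \in (x : {set gT})) = (coset N g == x).
Proof.
apply/idP/eqP => [gx|<-]; first exact: coset_mem.
by rewrite val_coset ?mem_cosetT // rcoset_refl.
Qed.

Definition grestr (x : coset_of N) (a : grpalg O gT) : grpalg O gT :=
  [ffun g => if coset N g == x then gcoef a g else 0].

Lemma gcoef_restr x a g :
  gcoef (grestr x a) g = if coset N g == x then gcoef a g else 0.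
Proof. by rewrite {1}/gcoef ffunE. Qed.

Lemma grestr_block x (a : blockalg b) : grestr x (\val a) \in block_pred b.
Proof.
rewrite inE; apply/andP; split.
  apply/supportedP => g gH; rewrite gcoef_restr.
  by rewrite (supportedP _ _ (blockalg_supp a) g gH) if_same.
apply/eqP/gcoefP => g; rewrite gcoef_restr gcoefM.
rewrite -[in RHS](blockalg_mull a) gcoefM.
transitivity (\sum_h (if coset N g == x then
    gcoef b h * gcoef (\val a) (h^-1 * g)%g else 0)); last first.
  by case: ifP => // _; rewrite big1.
apply: eq_bigr => h _; rewrite gcoef_restr.
have [hN|hN] := boolP (h \in N); last first.
  rewrite (supportedP _ _ (block_supp b) h) ?mul0r ?if_same //.
  by apply: contra hN; apply: (subsetP LN).
rewrite morphM ?mem_cosetT //= (coset_id (groupVr hN)) mul1g.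
by case: ifP; rewrite ?mulr0.
Qed.

Lemma blockalg_compP x (a : blockalg b) :
  reflect (forall g, coset N g != x -> gcoef (\val a) g = 0)
          (a \in blockalg_comp x).
Proof.
apply: (iffP (supportedP _ _)) => h g.
  by rewrite -mem_coset_of; apply: h.
by rewrite mem_coset_of; apply: h.
Qed.

Fact blockalg_graded : is_graded_algebra blockalg_comp.
Proof.
have cS x : submod_closed (blockalg_comp x).
  have [s0 sl] := supported_submod O (x : {set gT}).
  by split=> [|k u v]; rewrite !inE //; apply: sl.
split=> //; last first.
- move=> x y u v /blockalg_compP ux /blockalg_compP vy.
  apply/blockalg_compP => g gxy; rewrite gcoefM big1 // => h _.
  have [hx|hx] := eqVneq (coset N h) x; last by rewrite ux ?mul0r.
  rewrite vy ?mulr0 //; apply: contra gxy => /eqP <-.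
  by rewrite -hx -morphM ?mem_cosetT // mulKVg.
- apply/blockalg_compP => g; apply: contraNeq => bg.
  apply/eqP/coset_id/(subsetP LN); apply: contraNT bg => gL.
  by rewrite (supportedP _ _ (block_supp b) g gL).
split=> [x|a]; first exact: GRing.submod_closedB (cS x).
pose f := [ffun x => BlockAlg (grestr_block x a)]; exists f; split; last first.
  move=> f' [hf' a_f']; apply/ffunP => x; apply: val_inj; apply: gcoefP => g.
  rewrite ffunE /= gcoef_restr a_f'.
  have -> : \val (\sum_y f' y) = \sum_y \val (f' y) by exact: raddf_sum.
  rewrite (big_morph (gcoef^~ g) (fun u v => gcoefD u v g) (gcoef0 g)).
  case: eqP => [<-|/eqP gx]; last by rewrite (blockalg_compP _ _ (hf' x)).
  rewrite (bigD1 (coset N g)) //= big1 ?addr0 // => y ny.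
  by rewrite (blockalg_compP _ _ (hf' y)) // eq_sym.
split=> [x|]; first by apply/blockalg_compP => g; rewrite ffunE gcoef_restr => /negPf->.
apply: val_inj; apply: gcoefP => g.
have -> : \val (\sum_y f y) = \sum_y \val (f y) by exact: raddf_sum.
rewrite (big_morph (gcoef^~ g) (fun u v => gcoefD u v g) (gcoef0 g)).
rewrite (bigD1 (coset N g)) //= big1 ?addr0 => [|y ny].
  by rewrite ffunE gcoef_restr eqxx.
by rewrite ffunE gcoef_restr eq_sym (negPf ny).
Qed.

Lemma blockalg_gelt_proof (g : gT) : g \in H ->
  block_idem b * gelt O g \in block_pred b.
Proof.
move=> gH; rewrite inE mulrA block_idemM eqxx andbT -[X in supported X]mulGid.
by rewrite supportedM ?(supportedS (block_sub b) (block_supp b)) ?gelt_supported.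
Qed.

Lemma blockalg_gelt_comp (g : gT) (gH : g \in H) :
  BlockAlg (blockalg_gelt_proof gH) \in blockalg_comp (coset N g).
Proof.
apply/blockalg_compP => h /=; apply: contraNeq.
rewrite gcoefM => /eqP nz; apply/eqP.
have [k kN kgh] : exists2 k, k \in N & h = (k * g)%g.
  apply/exists2P; apply: contra_notP nz => hn; rewrite big1 // => k _.
  have [kL|kL] := boolP (k \in L); last first.
    by rewrite (supportedP _ _ (block_supp b) k kL) mul0r.
  rewrite gcoef_gelt; case: eqP => [e|]; last by rewrite mulr0.
  case: hn; exists k; split; first exact: (subsetP LN).
  by rewrite -e mulKVg.
by rewrite kgh morphM ?mem_cosetT //= (coset_id kN) mul1g.
Qed.

Fact blockalg_unit x : exists u v : blockalg b,
  [/\ u \in blockalg_comp x, v \in blockalg_comp x^-1%g, u * v = 1 & v * u = 1].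
Proof.
have [g gH gx] : exists2 g, g \in H & coset N g = x.
  have : repr x \in (H * N)%g by rewrite HN inE.
  case/mulsgP => g n gH nN' e; exists g => //.
  rewrite -(coset_reprK x) e morphM ?mem_cosetT //=.
  by rewrite (coset_id nN') mulg1.
exists (BlockAlg (blockalg_gelt_proof gH)),
       (BlockAlg (blockalg_gelt_proof (groupVr gH))).
have bc k : k \in H -> gelt O k * block_idem b = block_idem b * gelt O k.
  by move=> kH; rewrite block_comm ?gelt_supported.
split; first by rewrite -gx; apply: blockalg_gelt_comp.
- by rewrite -gx -morphV ?mem_cosetT //; apply: blockalg_gelt_comp.
- apply: val_inj => /=; rewrite mulrA -(mulrA (block_idem b)) bc //.
  by rewrite !mulrA block_idemM -mulrA -geltM mulgV gelt1 mulr1.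
- apply: val_inj => /=; rewrite mulrA -(mulrA (block_idem b)) bc ?groupV //.
  by rewrite !mulrA block_idemM -mulrA -geltM mulVg gelt1 mulr1.
Qed.

Definition block_crossed_product : crossed_product O (coset_of N) :=
  CrossedProduct blockalg_graded blockalg_unit.

End BlockCrossedProduct.

Lemma setT_mulg (gT : finGroupType) (N : {group gT}) :
  ([set: gT] * N)%g = [set: gT].
Proof. by apply: mulGSid; apply: subsetT. Qed.

Section Span.
Variable V : zmodType.

(* Additive submonoid generated by [P]; it is a subgroup in every use below,
   since the generating sets are stable under opposite. *)
Definition span (P : V -> Prop) : {pred V} :=
  [pred v | `[< exists s : seq V, (forall x, x \in s -> P x) /\
                                  v = \sum_(x <- s) x >]].

Lemma span0 P : 0 \in span P.
Proof. by apply/asboolP; exists [::]; rewrite big_nil; split. Qed.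

Lemma spanD P u v : u \in span P -> v \in span P -> u + v \in span P.
Proof.
move=> /asboolP [s [hs ->]] /asboolP [t [ht ->]]; apply/asboolP.
exists (s ++ t); rewrite big_cat; split=> // x.
by rewrite mem_cat => /orP [/hs|/ht].
Qed.

Lemma span_gen (P : V -> Prop) v : P v -> v \in span P.
Proof.
move=> hv; apply/asboolP; exists [:: v]; rewrite big_seq1; split=> // x.
by rewrite inE => /eqP ->.
Qed.

Lemma span_ind (P : V -> Prop) (K : V -> Prop) :
  K 0 -> (forall u v, P u -> K v -> K (u + v)) ->
  forall v, v \in span P -> K v.
Proof.
move=> K0 KD v /asboolP [s [hs ->]]; elim: s hs => [|x s IH] hs.
  by rewrite big_nil.
rewrite big_cons; apply: KD; first by apply: hs; rewrite inE eqxx.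
by apply: IH => y ys; apply: hs; rewrite inE ys orbT.
Qed.

Lemma span_zmod (P : V -> Prop) :
  (forall v, P v -> P (- v)) -> zmod_closed (span P).
Proof.
move=> PN; split=> [|u v hu hv]; first exact: span0.
apply: spanD => //; elim/span_ind: v / hv => [|w v Pw hv].
  by rewrite oppr0; apply: span0.
by rewrite opprD; apply: spanD => //; apply: span_gen; apply: PN.
Qed.

End Span.

Section Tensor.
Variables (U V : zmodType) (R : Type) (ra : U -> R -> U) (la : R -> V -> V).

(* Formal sums of pairs, modulo the congruence generated by biadditivity and by
   the relations [(u c) (x) v = u (x) (c v)]. *)
Inductive tens_rel : seq (U * V) -> seq (U * V) -> Prop :=
| TensRefl s : tens_rel s s
| TensSym s t : tens_rel s t -> tens_rel t s
| TensTrans s t r : tens_rel s t -> tens_rel t r -> tens_rel s r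
| TensCat s s' t t' : tens_rel s s' -> tens_rel t t' -> tens_rel (s ++ t) (s' ++ t')
| TensComm s t : tens_rel (s ++ t) (t ++ s)
| Tens0l v : tens_rel [:: (0, v)] [::]
| Tens0r u : tens_rel [:: (u, 0)] [::]
| TensDl u u' v : tens_rel [:: (u + u', v)] [:: (u, v); (u', v)]
| TensDr u v v' : tens_rel [:: (u, v + v')] [:: (u, v); (u, v')]
| TensBal u c v : tens_rel [:: (ra u c, v)] [:: (u, la c v)].

Definition tens_relb (s t : seq (U * V)) : bool := `[< tens_rel s t >].

Fact tens_relb_refl : reflexive tens_relb.
Proof. by move=> s; apply/asboolP/TensRefl. Qed.
Fact tens_relb_sym : symmetric tens_relb.
Proof. by move=> s t; apply/asboolP/asboolP; apply: TensSym. Qed.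
Fact tens_relb_trans : transitive tens_relb.
Proof. by move=> t s r /asboolP st /asboolP tr; apply/asboolP/(TensTrans st). Qed.

Canonical tens_equiv :=
  EquivRel tens_relb tens_relb_refl tens_relb_sym tens_relb_trans.

Definition tensor : Type := {eq_quot tens_equiv}.
HB.instance Definition _ := EqQuotient.on tensor.
HB.instance Definition _ := Choice.on tensor.

Definition tpi (s : seq (U * V)) : tensor := \pi_tensor s.

Lemma tpiP s t : tpi s = tpi t <-> tens_rel s t.
Proof.
by split=> [/eqquotP/asboolP|h]; last by apply/eqquotP/asboolP.
Qed.

Lemma tpiK t : tpi (generic_quotient.repr t) = t. Proof. exact: reprK. Qed.

Definition tens_add (x y : tensor) : tensor := tpi (generic_quotient.repr x ++ generic_quotient.repr y).
Definition tens_opp (x : tensor) : tensor :=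
  tpi [seq (- p.1, p.2) | p <- generic_quotient.repr x].

Lemma tens_addE s t : tens_add (tpi s) (tpi t) = tpi (s ++ t).
Proof. by apply/tpiP/TensCat; apply/tpiP; rewrite tpiK. Qed.

Lemma tens_opp_rel s t : tens_rel s t ->
  tens_rel [seq (- p.1, p.2) | p <- s] [seq (- p.1, p.2) | p <- t].
Proof.
elim=> {s t} /=.
- by move=> s; apply: TensRefl.
- by move=> s t _; apply: TensSym.
- by move=> s t r _ h1 _; apply: TensTrans.
- by move=> s s' t t' _ h1 _ h2; rewrite !map_cat; apply: TensCat.
- by move=> s t; rewrite !map_cat; apply: TensComm.
- by move=> v; rewrite oppr0; apply: Tens0l.
- by move=> u; apply: Tens0r.
- by move=> u u' v; rewrite opprD; apply: TensDl.
- by move=> u v v'; apply: TensDr.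
- move=> u c v.
  have key w x : tens_rel ([:: (w, x)] ++ [:: (- w, x)]) [::].
    apply: TensTrans (TensSym (TensDl _ _ _)) _.
    by rewrite subrr; apply: Tens0l.
  have h1 := key (ra u c) v; have h2 := key u (la c v).
  apply: (TensTrans (t := [:: (- ra u c, v)] ++
                          ([:: (u, la c v)] ++ [:: (- u, la c v)]))).
    rewrite -{1}[[:: (- ra u c, v)]]cats0.
    by apply: TensCat; [apply: TensRefl|apply: TensSym].
  rewrite catA -[[:: (- u, la c v)] in X in tens_rel _ X]cat0s.
  apply: TensCat; last exact: TensRefl.
  apply: TensTrans h1; apply: TensTrans (TensComm _ _) _.
  by apply: TensCat; [apply/TensSym/TensBal|apply: TensRefl].
Qed.

Lemma tens_oppE s : tens_opp (tpi s) = tpi [seq (- p.1, p.2) | p <- s].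
Proof. by apply/tpiP/tens_opp_rel/tpiP; rewrite tpiK. Qed.

Fact tens_addA : associative tens_add.
Proof.
move=> x y z; rewrite -[x]tpiK -[y]tpiK -[z]tpiK.
by rewrite !tens_addE catA.
Qed.
Fact tens_addC : commutative tens_add.
Proof.
move=> x y; rewrite -[x]tpiK -[y]tpiK !tens_addE.
exact/tpiP/TensComm.
Qed.
Fact tens_add0 : left_id (tpi [::]) tens_add.
Proof. by move=> x; rewrite -[x]tpiK tens_addE. Qed.
Fact tens_addN : left_inverse (tpi [::]) tens_opp tens_add.
Proof.
move=> x; rewrite -[x]tpiK tens_oppE tens_addE; apply/tpiP.
elim: (generic_quotient.repr x) => [|p s IH] /=; first exact: TensRefl.
rewrite -cat1s -[p :: s]cat1s catA.
set s' := map _ _ in IH *.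
apply: (TensTrans (t := ([:: (- p.1, p.2)] ++ [:: p]) ++ (s' ++ s))).
  rewrite -!catA; apply: TensCat; first exact: TensRefl.
  by rewrite !catA; apply: TensCat; [apply: TensComm|apply: TensRefl].
rewrite -[X in tens_rel _ X]cats0; apply: TensCat; last exact: IH.
case: p => u v /=; apply: TensTrans (TensSym (TensDl _ _ _)) _.
by rewrite addNr; apply: Tens0l.
Qed.
HB.instance Definition _ := GRing.isZmodule.Build tensor
  tens_addA tens_addC tens_add0 tens_addN.

Definition tens (u : U) (v : V) : tensor := tpi [:: (u, v)].

Lemma tensDl u u' v : tens (u + u') v = tens u v + tens u' v.
Proof. by rewrite [RHS]tens_addE; apply/tpiP/TensDl. Qed.
Lemma tensDr u v v' : tens u (v + v') = tens u v + tens u v'.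
Proof. by rewrite [RHS]tens_addE; apply/tpiP/TensDr. Qed.
Lemma tens0l v : tens 0 v = 0. Proof. exact/tpiP/Tens0l. Qed.
Lemma tens0r u : tens u 0 = 0. Proof. exact/tpiP/Tens0r. Qed.
Lemma tensNl u v : tens (- u) v = - tens u v.
Proof. by apply: (addrI (tens u v)); rewrite -tensDl !subrr tens0l. Qed.
Lemma tens_bal u c v : tens (ra u c) v = tens u (la c v).
Proof. exact/tpiP/TensBal. Qed.

Lemma tpi_sum s : tpi s = \sum_(p <- s) tens p.1 p.2.
Proof.
elim: s => [|[u v] s IH]; first by rewrite big_nil.
by rewrite big_cons -IH [RHS]tens_addE.
Qed.

Lemma tens_ind (P : tensor -> Prop) :
  P 0 -> (forall u v t, P t -> P (tens u v + t)) -> forall t, P t.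
Proof.
move=> P0 PD t; rewrite -[t]tpiK tpi_sum.
by elim: (generic_quotient.repr t) => [|p s IH]; rewrite ?big_nil // big_cons; apply: PD.
Qed.

(* The additive map induced by a balanced map. *)
Definition balanced (W : zmodType) (h : U -> V -> W) : Prop :=
  [/\ forall u u' v, h (u + u') v = h u v + h u' v,
      forall u v v', h u (v + v') = h u v + h u v'
    & forall u c v, h (ra u c) v = h u (la c v)].

Definition tlift (W : zmodType) (h : U -> V -> W) (t : tensor) : W :=
  \sum_(p <- generic_quotient.repr t) h p.1 p.2.

Section Lift.
Variables (W : zmodType) (h : U -> V -> W).
Hypothesis hb : balanced h.

Lemma bal0l v : h 0 v = 0.
Proof. by case: hb => hl _ _; apply: (addrI (h 0 v)); rewrite -hl !addr0. Qed.
Lemma bal0r u : h u 0 = 0.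
Proof. by case: hb => _ hr _; apply: (addrI (h u 0)); rewrite -hr !addr0. Qed.

Lemma tlift_rel s t : tens_rel s t ->
  \sum_(p <- s) h p.1 p.2 = \sum_(p <- t) h p.1 p.2.
Proof.
case: hb => hl hr hc; elim=> {s t} //=.
- by move=> s t r _ e1 _ e2; rewrite e1 e2.
- by move=> s s' t t' _ e _ e'; rewrite !big_cat /= e e'.
- by move=> s t; rewrite !big_cat /= addrC.
- by move=> v; rewrite big_seq1 big_nil bal0l.
- by move=> u; rewrite big_seq1 big_nil bal0r.
- by move=> u u' v; rewrite big_seq1 big_cons big_seq1 hl.
- by move=> u v v'; rewrite big_seq1 big_cons big_seq1 hr.
- by move=> u c v; rewrite !big_seq1 hc.
Qed.

Lemma tlift_tpi s : tlift h (tpi s) = \sum_(p <- s) h p.1 p.2.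
Proof. by apply/tlift_rel/tpiP; rewrite tpiK. Qed.

Lemma tliftE u v : tlift h (tens u v) = h u v.
Proof. by rewrite tlift_tpi big_seq1. Qed.

Lemma tliftD : {morph tlift h : x y / x + y}.
Proof.
move=> x y; rewrite -[x]tpiK -[y]tpiK.
have -> : forall s t, tpi s + tpi t = tpi (s ++ t) by exact: tens_addE.
by rewrite !tlift_tpi big_cat.
Qed.

Lemma tlift0 : tlift h 0 = 0.
Proof. by apply: (addrI (tlift h 0)); rewrite -tliftD !addr0. Qed.

End Lift.
End Tensor.

Arguments tpi {U V R ra la} s.
Arguments tens {U V R ra la} u v.
Arguments tlift {U V R ra la W} h t.

Definition is_lmodule (R : pzRingType) (V : zmodType) (l : R -> V -> V) : Prop :=
  [/\ forall x, l 1 x = x, forall a b x, l (a * b) x = l a (l b x),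
      forall a x y, l a (x + y) = l a x + l a y
    & forall a b x, l (a + b) x = l a x + l b x].

Definition is_rmodule (R : pzRingType) (V : zmodType) (r : V -> R -> V) : Prop :=
  [/\ forall x, r x 1 = x, forall a b x, r x (a * b) = r (r x a) b,
      forall a x y, r (x + y) a = r x a + r y a
    & forall a b x, r x (a + b) = r x a + r x b].

(* The base ring [O] acts in the same way on both sides. *)
Definition is_bimodule (O : comNzRingType) (R S : algType O) (V : zmodType)
    (l : R -> V -> V) (r : V -> S -> V) : Prop :=
  [/\ is_lmodule l, is_rmodule r, forall a x b, r (l a x) b = l a (r x b)
    & forall (k : O) x, l k%:A x = r x k%:A].

Record bimodule (O : comNzRingType) (R S : algType O) := Bimodule {
  bm_car :> zmodType;
  bm_l : R -> bm_car -> bm_car;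
  bm_r : bm_car -> S -> bm_car;
  bm_P : is_bimodule bm_l bm_r
}.
Arguments bm_l {O R S} b.
Arguments bm_r {O R S} b.

Section BimoduleTheory.
Variables (O : comNzRingType) (R S : algType O) (M : bimodule R S).
Local Notation l := (bm_l M).
Local Notation r := (bm_r M).

Lemma bm_l1 x : l 1 x = x. Proof. by case: (bm_P M) => [[]]. Qed.
Lemma bm_lM a b x : l (a * b) x = l a (l b x).
Proof. by case: (bm_P M) => [[]]. Qed.
Lemma bm_lDr a x y : l a (x + y) = l a x + l a y.
Proof. by case: (bm_P M) => [[]]. Qed.
Lemma bm_lDl a b x : l (a + b) x = l a x + l b x.
Proof. by case: (bm_P M) => [[]]. Qed.
Lemma bm_r1 x : r x 1 = x. Proof. by case: (bm_P M) => _ []. Qed.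
Lemma bm_rM a b x : r x (a * b) = r (r x a) b.
Proof. by case: (bm_P M) => _ []. Qed.
Lemma bm_rDl a x y : r (x + y) a = r x a + r y a.
Proof. by case: (bm_P M) => _ []. Qed.
Lemma bm_rDr a b x : r x (a + b) = r x a + r x b.
Proof. by case: (bm_P M) => _ []. Qed.
Lemma bm_lr a x b : r (l a x) b = l a (r x b).
Proof. by case: (bm_P M). Qed.
Lemma bm_A (k : O) x : l k%:A x = r x k%:A.
Proof. by case: (bm_P M). Qed.

End BimoduleTheory.

Section Dual.
Variables (O : comNzRingType) (R S : algType O) (M : bimodule R S).

Definition lhom_pred : {pred M -> R} := [pred f : M -> R |
  `[< (forall x y, f (x + y) = f x + f y) /\
      (forall a x, f (bm_l M a x) = a * f x) >]].

Fact lhom_zmod_closed : zmod_closed lhom_pred.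
Proof.
split=> [|f g /asboolP [fD fZ] /asboolP [gD gZ]]; apply/asboolP; split.
- by move=> x y; rewrite addr0.
- by move=> a x; rewrite mulr0.
- by move=> x y; rewrite !fctE fD gD opprD addrACA.
- by move=> a x; rewrite !fctE fZ gZ mulrBr.
Qed.
HB.instance Definition _ := GRing.isZmodClosed.Build (M -> R) lhom_pred
  lhom_zmod_closed.

(* [Hom_R(M, R)], the homomorphisms of left [R]-modules. *)
Record lhom := LHom { lhom_fun :> M -> R; lhom_P : lhom_fun \in lhom_pred }.
HB.instance Definition _ := [isSub for lhom_fun].
HB.instance Definition _ := [Choice of lhom by <:].
HB.instance Definition _ := [SubChoice_isSubZmodule of lhom by <:].

Lemma lhomDr (f : lhom) x y : f (x + y) = f x + f y.
Proof. by case: f => f /= /asboolP []. Qed.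
Lemma lhomZ (f : lhom) a x : f (bm_l M a x) = a * f x.
Proof. by case: f => f /= /asboolP []. Qed.
Lemma lhomDl (f g : lhom) x : (f + g) x = f x + g x.
Proof. by []. Qed.
Lemma lhom0r (f : lhom) : f 0 = 0.
Proof. by apply: (addrI (f 0)); rewrite -lhomDr !addr0. Qed.
Lemma lhom_sumr (f : lhom) (I : Type) (r : seq I) (F : I -> M) :
  f (\sum_(i <- r) F i) = \sum_(i <- r) f (F i).
Proof. exact: (big_morph _ (lhomDr f) (lhom0r f)). Qed.
Lemma lhom_suml (I : Type) (r : seq I) (F : I -> lhom) m :
  (\sum_(i <- r) F i : lhom) m = \sum_(i <- r) F i m.
Proof. by elim/big_rec2: _ => // i _ f _ <-. Qed.
Lemma lhomP (f g : lhom) : f =1 g -> f = g.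
Proof. by move=> e; apply: val_inj; apply/funext. Qed.

Fact dual_l_proof (s : S) (f : lhom) : (fun m => f (bm_r M m s)) \in lhom_pred.
Proof.
apply/asboolP; split=> [x y|a x]; first by rewrite bm_rDl lhomDr.
by rewrite bm_lr lhomZ.
Qed.
Definition dual_l (s : S) (f : lhom) : lhom := LHom (dual_l_proof s f).

Fact dual_r_proof (f : lhom) (a : R) : (fun m => f m * a) \in lhom_pred.
Proof.
apply/asboolP; split=> [x y|c x]; first by rewrite lhomDr mulrDl.
by rewrite lhomZ mulrA.
Qed.
Definition dual_r (f : lhom) (a : R) : lhom := LHom (dual_r_proof f a).

Fact dual_bimodule : is_bimodule dual_l dual_r.
Proof.
split=> [||s f a|k f]; first split; last 1 first.
- apply: lhomP => m /=; rewrite -bm_A lhomZ.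
  by rewrite -scalerAl mul1r -scalerAr mulr1.
- by move=> f; apply: lhomP => m /=; rewrite bm_r1.
- by move=> a b f; apply: lhomP => m /=; rewrite bm_rM.
- by move=> a f g; apply: lhomP => m.
- by move=> a b f; apply: lhomP => m /=; rewrite bm_rDr lhomDr.
- split=> [f|a b f|a f g|a b f]; apply: lhomP => m /=.
  + by rewrite mulr1.
  + by rewrite mulrA.
  + by rewrite mulrDl.
  + by rewrite mulrDr.
- by apply: lhomP.
Qed.

Definition dual : bimodule S R := Bimodule dual_bimodule.

End Dual.

Section TensorBimodule.
Variables (O : comNzRingType) (R S T : algType O).
Variables (M : bimodule R S) (N : bimodule S T).

Definition btensor : zmodType := tensor (bm_r M) (bm_l N).
Definition btens (m : M) (n : N) : btensor := tens m n.
Definition btens_l (a : R) : btensor -> btensor :=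
  tlift (fun m n => btens (bm_l M a m) n).
Definition btens_r (t : btensor) (c : T) : btensor :=
  tlift (fun m n => btens m (bm_r N n c)) t.

Lemma btens_l_bal a :
  balanced (bm_r M) (bm_l N) (fun m n => btens (bm_l M a m) n).
Proof.
split=> *; rewrite /btens; first by rewrite bm_lDr tensDl.
- by rewrite tensDr.
- by rewrite -bm_lr tens_bal.
Qed.
Lemma btens_r_bal c :
  balanced (bm_r M) (bm_l N) (fun m n => btens m (bm_r N n c)).
Proof.
split=> *; rewrite /btens; first by rewrite tensDl.
- by rewrite bm_rDl tensDr.
- by rewrite tens_bal bm_lr.
Qed.
Lemma btens_lE a m n : btens_l a (btens m n) = btens (bm_l M a m) n.
Proof. exact: tliftE (btens_l_bal a) _ _. Qed.
Lemma btens_rE m n c : btens_r (btens m n) c = btens m (bm_r N n c).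
Proof. exact: tliftE (btens_r_bal c) _ _. Qed.
Lemma btens_lD a x y : btens_l a (x + y) = btens_l a x + btens_l a y.
Proof. exact: tliftD (btens_l_bal a) _ _. Qed.
Lemma btens_rD c x y : btens_r (x + y) c = btens_r x c + btens_r y c.
Proof. exact: tliftD (btens_r_bal c) _ _. Qed.
Lemma btens_l0 a : btens_l a 0 = 0.
Proof. exact: tlift0 (btens_l_bal a). Qed.
Lemma btens_r0 c : btens_r 0 c = 0.
Proof. exact: tlift0 (btens_r_bal c). Qed.

Lemma btens_ind (P : btensor -> Prop) :
  P 0 -> (forall m n t, P t -> P (btens m n + t)) -> forall t, P t.
Proof. exact: tens_ind. Qed.

Fact btens_bimodule : is_bimodule btens_l btens_r.
Proof.
split; first split.
- elim/btens_ind => [|m n t IH]; first exact: btens_l0.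
  by rewrite btens_lD IH btens_lE bm_l1.
- move=> a b; elim/btens_ind => [|m n t IH]; first by rewrite !btens_l0.
  by rewrite !btens_lD IH !btens_lE bm_lM.
- by move=> *; apply: btens_lD.
- move=> a b; elim/btens_ind => [|m n t IH]; first by rewrite !btens_l0 addr0.
  by rewrite !btens_lD IH !btens_lE bm_lDl /btens tensDl addrACA.
- split.
  + elim/btens_ind => [|m n t IH]; first exact: btens_r0.
    by rewrite btens_rD IH btens_rE bm_r1.
  + move=> a b; elim/btens_ind => [|m n t IH]; first by rewrite !btens_r0.
    by rewrite !btens_rD IH !btens_rE bm_rM.
  + by move=> *; apply: btens_rD.
  + move=> a b; elim/btens_ind => [|m n t IH]; first by rewrite !btens_r0 addr0.
    by rewrite !btens_rD IH !btens_rE bm_rDr /btens tensDr addrACA.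
- move=> a x c; elim/btens_ind: x => [|m n t IH].
    by rewrite !(btens_l0, btens_r0).
  by rewrite !(btens_lD, btens_rD) IH !(btens_lE, btens_rE).
- move=> k; elim/btens_ind => [|m n t IH]; first by rewrite btens_l0 btens_r0.
  by rewrite btens_lD btens_rD IH btens_lE btens_rE bm_A /btens tens_bal bm_A.
Qed.

Definition tens_bimodule : bimodule R T := Bimodule btens_bimodule.

End TensorBimodule.

Section TensorFunctor.
Variables (O : comNzRingType) (R S : algType O) (M : bimodule R S).

Section Object.
Variable X : lmodType S.

Definition mtensor : Type := tensor (bm_r M) (@GRing.scale S X).
HB.instance Definition _ := GRing.Zmodule.on mtensor.
Definition mtens (m : M) (x : X) : mtensor := tens m x.
Definition mtens_scale (a : R) : mtensor -> mtensor :=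
  tlift (fun m x => mtens (bm_l M a m) x).

Lemma mtens_bal a :
  balanced (bm_r M) (@GRing.scale S X) (fun m x => mtens (bm_l M a m) x).
Proof.
split=> *; rewrite /mtens; first by rewrite bm_lDr tensDl.
- by rewrite tensDr.
- by rewrite -bm_lr tens_bal.
Qed.
Lemma mtens_scaleE a m x : mtens_scale a (mtens m x) = mtens (bm_l M a m) x.
Proof. exact: tliftE (mtens_bal a) _ _. Qed.
Lemma mtens_scaleD a (x y : mtensor) :
  mtens_scale a (x + y) = mtens_scale a x + mtens_scale a y.
Proof. exact: tliftD (mtens_bal a) _ _. Qed.
Lemma mtens_scale0 a : mtens_scale a 0 = 0.
Proof. exact: tlift0 (mtens_bal a). Qed.

Lemma mtens_ind (P : mtensor -> Prop) :
  P 0 -> (forall m n t, P t -> P (mtens m n + t)) -> forall t, P t.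
Proof. exact: tens_ind. Qed.

Fact mtens_scaleA a b x : mtens_scale a (mtens_scale b x) = mtens_scale (a * b) x.
Proof.
elim/mtens_ind: x => [|m n t IH]; first by rewrite !mtens_scale0.
by rewrite !mtens_scaleD IH !mtens_scaleE bm_lM.
Qed.
Fact mtens_scale1 : left_id 1 mtens_scale.
Proof.
elim/mtens_ind => [|m n t IH]; first by rewrite !mtens_scale0.
by rewrite !mtens_scaleD IH !mtens_scaleE bm_l1.
Qed.
Fact mtens_scaleDl x : {morph mtens_scale^~ x : a b / a + b}.
Proof.
move=> a b; elim/mtens_ind: x => [|m n t IH] /=.
  by rewrite !mtens_scale0 addr0.
by rewrite !mtens_scaleD IH !mtens_scaleE bm_lDl /mtens tensDl addrACA.
Qed.
HB.instance Definition _ := GRing.Zmodule_isLmodule.Build R mtensor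
  mtens_scaleA mtens_scale1 mtens_scaleD mtens_scaleDl.

End Object.

Definition mtens_map (X Y : lmodType S) (f : X -> Y) : mtensor X -> mtensor Y :=
  tlift (fun m x => mtens m (f x)).

Lemma mtens_mapE (X Y : lmodType S) (f : {linear X -> Y}) m x :
  mtens_map f (mtens m x) = mtens m (f x).
Proof.
apply: tliftE; split=> *; rewrite /mtens ?linearD ?tensDl ?tensDr //.
by rewrite linearZ tens_bal.
Qed.

End TensorFunctor.

Section MoritaEquivalence.
Variables (O : comNzRingType) (R S : algType O).

(* The functor [N (x)_R (M (x)_S -)] on left [S]-modules is naturally isomorphic
   to the identity functor. *)
Definition composite_iso_id (M : bimodule R S) (N : bimodule S R) : Prop :=
  exists eta : forall X : lmodType S, {linear mtensor N (mtensor M X) -> X},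
    (forall X, bijective (eta X)) /\
    (forall (X Y : lmodType S) (f : {linear X -> Y}) t,
        eta Y (mtens_map (mtens_map f) t) = f (eta X t)).

End MoritaEquivalence.

Definition induce_morita (O : comNzRingType) (R S : algType O)
    (M : bimodule R S) (N : bimodule S R) : Prop :=
  composite_iso_id M N /\ composite_iso_id N M.

Section GradedBimodules.
Variables (O : comNzRingType) (Q : finGroupType) (C : graded_acted_algebra O Q).

Record gbimodule_data (A A' : cp_over C) := GBimoduleData {
  gd_car :> zmodType;
  gd_l : A -> gd_car -> gd_car;
  gd_r : gd_car -> A' -> gd_car;
  gd_comp : Q -> {pred gd_car}
}.

Arguments gd_comp {A A'} _ _.
Arguments gd_l {A A'} {_} _ _.
Arguments gd_r {A A'} {_} _ _.

Definition is_gbimodule (A A' : cp_over C) (M : gbimodule_data A A') : Prop :=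
  [/\ is_bimodule (@gd_l A A' M) (@gd_r A A' M), is_grading (gd_comp M),
      forall g x h a m a', a \in cp_comp A g -> m \in gd_comp M x ->
        a' \in cp_comp A' h -> gd_r (gd_l a m) a' \in gd_comp M (g * x * h)%g
    & forall g m c, m \in gd_comp M g ->
        gd_r m (co_map A' c) = gd_l (co_map A (ga_act C g c)) m].

Record gbimodule (A A' : cp_over C) := GBimodule {
  gb_data :> gbimodule_data A A';
  gb_P : is_gbimodule gb_data
}.

Definition gb_bimodule (A A' : cp_over C) (M : gbimodule A A') : bimodule A A' :=
  Bimodule (let: And4 h _ _ _ := gb_P M in h).

(* Isomorphism of graded bimodules: linearity for the actions of [A] and [A']
   entails [C]-linearity, as [C] acts through [zeta] and [zeta']. *)
Definition giso (A A' : cp_over C) (M N : gbimodule_data A A') : Prop :=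
  exists f : M -> N,
    [/\ bijective f, {morph f : x y / x + y},
        forall a x, f (gd_l a x) = gd_l a (f x),
        forall x a, f (gd_r x a) = gd_r (f x) a
      & forall g x, (f x \in gd_comp N g) = (x \in gd_comp M g)].

Section Theory.
Variables (A A' : cp_over C) (M : gbimodule A A').

Lemma gb_grading : is_grading (gd_comp M). Proof. by case: (gb_P M). Qed.
Lemma gb_comp_l g x a m :
  a \in cp_comp A g -> m \in gd_comp M x -> gd_l a m \in gd_comp M (g * x)%g.
Proof.
case: (gb_P M) => _ _ h _ ag mx.
rewrite -[(g * x)%g]mulg1 -[gd_l a m](@bm_r1 _ _ _ (gb_bimodule M)).
by apply: h => //; apply: cp_comp1.
Qed.
Lemma gb_comp_r h x a m :
  a \in cp_comp A' h -> m \in gd_comp M x -> gd_r m a \in gd_comp M (x * h)%g.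
Proof.
case: (gb_P M) => _ _ hh _ ah mx.
rewrite -[(x * h)%g]mul1g mulgA -[m](@bm_l1 _ _ _ (gb_bimodule M)).
by apply: hh => //; apply: cp_comp1.
Qed.
Lemma gb_C g m c : m \in gd_comp M g ->
  gd_r m (co_map A' c) = gd_l (co_map A (ga_act C g c)) m.
Proof. by case: (gb_P M) => _ _ _ h; apply: h. Qed.

Lemma gb_lDr a (x y : M) : gd_l a (x + y) = gd_l a x + gd_l a y.
Proof. exact: (@bm_lDr _ _ _ (gb_bimodule M)). Qed.
Lemma gb_lDl a b (x : M) : gd_l (a + b) x = gd_l a x + gd_l b x.
Proof. exact: (@bm_lDl _ _ _ (gb_bimodule M)). Qed.
Lemma gb_rDl a (x y : M) : gd_r (x + y) a = gd_r x a + gd_r y a.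
Proof. exact: (@bm_rDl _ _ _ (gb_bimodule M)). Qed.
Lemma gb_rDr a b (x : M) : gd_r x (a + b) = gd_r x a + gd_r x b.
Proof. exact: (@bm_rDr _ _ _ (gb_bimodule M)). Qed.
Lemma gb_lhomZ (f : lhom (gb_bimodule M)) a (m : M) : f (gd_l a m) = a * f m.
Proof. exact: lhomZ. Qed.

Lemma gb_l0 a : gd_l a 0 = 0 :> M.
Proof.
by apply: (addrI (gd_l a 0)); rewrite -(@bm_lDr _ _ _ (gb_bimodule M)) !addr0.
Qed.
Lemma gb_0l x : gd_l 0 x = 0 :> M.
Proof.
by apply: (addrI (gd_l 0 x)); rewrite -(@bm_lDl _ _ _ (gb_bimodule M)) !addr0.
Qed.
Lemma gb_r0 a : gd_r 0 a = 0 :> M.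
Proof.
by apply: (addrI (gd_r 0 a)); rewrite -(@bm_rDl _ _ _ (gb_bimodule M)) !addr0.
Qed.
Lemma gb_0r x : gd_r x 0 = 0 :> M.
Proof.
by apply: (addrI (gd_r x 0)); rewrite -(@bm_rDr _ _ _ (gb_bimodule M)) !addr0.
Qed.
Lemma gb_l_sum a (I : Type) (r : seq I) (F : I -> M) :
  gd_l a (\sum_(i <- r) F i) = \sum_(i <- r) gd_l a (F i).
Proof. exact: (big_morph _ (@bm_lDr _ _ _ (gb_bimodule M) a) (gb_l0 a)). Qed.
Lemma gb_r_sum a (I : Type) (r : seq I) (F : I -> M) :
  gd_r (\sum_(i <- r) F i) a = \sum_(i <- r) gd_r (F i) a.
Proof.
exact: (big_morph (fun x => gd_r x a) (@bm_rDl _ _ _ (gb_bimodule M) a) (gb_r0 a)).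
Qed.

Lemma gproj_l k a m g : a \in cp_comp A k ->
  gproj gb_grading g (gd_l a m) = gd_l a (gproj gb_grading (k^-1 * g)%g m).
Proof.
move=> ak.
rewrite (@gproj_uniq _ _ _ _ _
  [ffun h => gd_l a (gproj gb_grading (k^-1 * h)%g m)]) ?ffunE //.
split=> [h|].
  by rewrite ffunE -{2}(mulKVg k h) gb_comp_l // gproj_mem.
rewrite {1}(gproj_sum gb_grading m) gb_l_sum (reindex_inj (mulgI k^-1%g)) /=.
by apply: eq_bigr => h _; rewrite ffunE.
Qed.

Lemma gproj_r k a m g : a \in cp_comp A' k ->
  gproj gb_grading g (gd_r m a) = gd_r (gproj gb_grading (g * k^-1)%g m) a.
Proof.
move=> ak.
rewrite (@gproj_uniq _ _ _ _ _
  [ffun h => gd_r (gproj gb_grading (h * k^-1)%g m) a]) ?ffunE //.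
split=> [h|].
  by rewrite ffunE -{2}(mulgKV k h) gb_comp_r // gproj_mem.
rewrite {1}(gproj_sum gb_grading m) gb_r_sum (reindex_inj (mulIg k^-1%g)) /=.
by apply: eq_bigr => h _; rewrite ffunE.
Qed.

End Theory.

Lemma hom_ext (V W : zmodType) (Vg : Q -> {pred V}) (gV : is_grading Vg)
    (F G : V -> W) :
  {morph F : x y / x + y} -> {morph G : x y / x + y} ->
  (forall g v, v \in Vg g -> F v = G v) -> F =1 G.
Proof.
move=> FD GD FG v.
have F0 : F 0 = 0 by apply: (addrI (F 0)); rewrite -FD !addr0.
have G0 : G 0 = 0 by apply: (addrI (G 0)); rewrite -GD !addr0.
rewrite (gproj_sum gV v) (big_morph _ FD F0) (big_morph _ GD G0).
by apply: eq_bigr => g _; apply: FG (gproj_mem gV g v).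
Qed.

Section Regular.
Variable A : cp_over C.

Definition greg_data : gbimodule_data A A :=
  @GBimoduleData A A A (fun a x => a * x) (fun x a => x * a) (cp_comp A).

Fact greg_proof : is_gbimodule greg_data.
Proof.
split=> [||g x h a m a' ag mx ah|g m c mg] /=.
- split=> [||a x b|k x]; rewrite ?mulrA //.
  + by split=> *; rewrite ?mul1r ?mulrA ?mulrDl ?mulrDr.
  + by split=> *; rewrite ?mulr1 ?mulrA ?mulrDl ?mulrDr.
  + by rewrite -scalerAl -scalerAr mul1r mulr1.
- exact: cp_grading.
- by rewrite !cp_compM.
- exact: co_commute (co_mapP A) mg.
Qed.

Definition greg : gbimodule A A := GBimodule greg_proof.

End Regular.

Section GradedDual.
Variables (A A' : cp_over C) (M : gbimodule A A').
Local Notation D := (dual (gb_bimodule M)).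

Definition gdual_comp (x : Q) : {pred D} := [pred f : D |
  `[< forall g m, m \in gd_comp M g -> (f : lhom _) m \in cp_comp A (g * x)%g >]].

Definition gdual_data : gbimodule_data A' A :=
  @GBimoduleData A' A D (bm_l D) (bm_r D) gdual_comp.

Let gM := gb_grading M.
Let gA := cp_grading A.

Fact gdual_part_proof (f : lhom (gb_bimodule M)) (x : Q) :
  (fun m : gb_bimodule M => \sum_g gproj gA (g * x)%g (f (gproj gM g m)))
    \in @lhom_pred _ _ _ (gb_bimodule M).
Proof.
have FD : {morph (fun m : gb_bimodule M =>
    \sum_g gproj gA (g * x)%g (f (gproj gM g m))) : m n / m + n}.
  move=> m n /=; rewrite -big_split /=; apply: eq_bigr => g _.
  by rewrite gprojD lhomDr gprojD.
apply/asboolP; split=> [|a m]; first exact: FD.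
pose F (a : A) : A := \sum_g gproj gA (g * x)%g (f (gproj gM g (gd_l a m))).
pose G (a : A) : A := a * \sum_g gproj gA (g * x)%g (f (gproj gM g m)).
apply: (@hom_ext A A (cp_comp A) gA F G) => [b c|b c|k b bk]; rewrite /F /G.
- rewrite -big_split /=; apply: eq_bigr => g _.
  by rewrite gb_lDl gprojD lhomDr gprojD.
- by rewrite mulrDl.
- rewrite mulr_sumr (reindex_inj (mulgI k)) /=; apply: eq_bigr => g _.
  rewrite (gproj_l _ _ bk) mulKg.
  rewrite gb_lhomZ.
  by rewrite (cp_proj_l _ _ bk) -mulgA mulKg.
Qed.

Definition gdual_part (f : D) (x : Q) : D := LHom (gdual_part_proof f x).

Fact gdual_proof : is_gbimodule gdual_data.
Proof.
split=> [||g x h a f a' ag /asboolP fx ah|x f c /asboolP fx] /=.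
- exact: (bm_P D).
- split=> [x|f].
    split=> [|f f' /asboolP hf /asboolP hf']; apply/asboolP => g m mg /=.
      exact: gcomp0.
    by apply: (gcompB gA); [apply: hf|apply: hf'].
  exists [ffun x => gdual_part f x]; split=> [|F [hF ->]].
    split=> [x|].
      rewrite ffunE; apply/asboolP => g m mg /=.
      apply: gcomp_sum => // k _; rewrite (gproj_hom gM _ mg).
      case: eqP => [->|_]; first exact: gproj_mem.
      by rewrite lhom0r gproj0 gcomp0.
    apply: lhomP => m; rewrite lhom_suml.
    under eq_bigr => x _ do rewrite ffunE /=.
    rewrite exchange_big /= {1}(gproj_sum gM m) lhom_sumr.
    apply: eq_bigr => g _; rewrite {1}(gproj_sum gA (f _)).
    by rewrite (reindex_inj (mulgI g)).
  apply/ffunP => x; rewrite ffunE; apply: lhomP => m /=.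
  rewrite {2}(gproj_sum gM m) lhom_sumr; apply: eq_bigr => g _.
  rewrite lhom_suml gproj_big (bigD1 x) //= big1 => [|y nyx].
    have /asboolP h := hF x.
    by rewrite (gproj_hom gA _ (h g _ (gproj_mem gM g m))) eqxx addr0.
  have /asboolP h := hF y.
  by rewrite (gproj_hom gA _ (h g _ (gproj_mem gM g m))) (inj_eq (mulgI g))
    eq_sym (negPf nyx).
- apply/asboolP => k m mk /=; rewrite !mulgA.
  by apply: cp_compM ah; apply: fx; apply: gb_comp_r.
- apply: lhomP => m /=.
  apply: (@hom_ext _ _ _ gM (fun m => lhom_fun f m * co_map A c)
    (fun m => lhom_fun f (gd_r m (co_map A' (ga_act C x c))))) => [u v|u v|g v vg].
  + by rewrite lhomDr mulrDl.
  + by rewrite gb_rDl lhomDr.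
  rewrite (gb_C _ vg) gb_lhomZ -ga_actM.
  by rewrite (co_commute _ (co_mapP A) (fx _ _ vg)).
Qed.

Definition gdual : gbimodule A' A := GBimodule gdual_proof.

End GradedDual.

Section GradedTensor.
Variables (A A' A'' : cp_over C) (M : gbimodule A A') (N : gbimodule A' A'').
Local Notation bM := (gb_bimodule M).
Local Notation bN := (gb_bimodule N).
Local Notation T := (tens_bimodule bM bN).

Definition gtens_gen (x : Q) (t : T) : Prop :=
  exists g h m n, [/\ m \in gd_comp M g, n \in gd_comp N h, (g * h)%g = x
                    & t = btens (m : bM) (n : bN)].
Definition gtens_comp (x : Q) : {pred T} := span (gtens_gen x).

Definition gtens_data : gbimodule_data A A'' :=
  @GBimoduleData A A'' T (bm_l T) (bm_r T) gtens_comp.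

Let gM := gb_grading M.
Let gN := gb_grading N.

Definition gtens_proj (x : Q) : btensor bM bN -> btensor bM bN :=
  tlift (fun m n =>
    \sum_g btens (gproj gM g m : bM) (gproj gN (g^-1 * x)%g n : bN)).

Lemma gtens_proj_bal x : balanced (bm_r bM) (bm_l bN) (fun m n =>
    \sum_g btens (gproj gM g m : bM) (gproj gN (g^-1 * x)%g n : bN)).
Proof.
split=> [m m' n|m n n'|m c n].
- by rewrite -big_split; apply: eq_bigr => g _; rewrite /= gprojD [LHS]tensDl.
- by rewrite -big_split; apply: eq_bigr => g _; rewrite /= gprojD [LHS]tensDr.
pose F (c : A') := \sum_g btens (gproj gM g (gd_r m c) : bM)
  (gproj gN (g^-1 * x)%g n : bN).
pose G (c : A') := \sum_g btens (gproj gM g m : bM)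
  (gproj gN (g^-1 * x)%g (gd_l c n) : bN).
apply: (@hom_ext _ _ _ (cp_grading A') F G) => [a b|a b|k b bk]; rewrite /F /G.
- rewrite -big_split; apply: eq_bigr => g _.
  by rewrite /= gb_rDr gprojD [LHS]tensDl.
- rewrite -big_split; apply: eq_bigr => g _.
  by rewrite /= gb_lDl gprojD [LHS]tensDr.
- rewrite (reindex_inj (mulIg k)); apply: eq_bigr => g _ /=.
  rewrite (gproj_r _ _ bk) (gproj_l _ _ bk) mulgK invMg mulgA.
  exact: tens_bal.
Qed.

Lemma gtens_projE x m n : gtens_proj x (btens m n) =
  \sum_g btens (gproj gM g m : bM) (gproj gN (g^-1 * x)%g n : bN).
Proof. exact: tliftE (gtens_proj_bal x) _ _. Qed.
Lemma gtens_projD x : {morph gtens_proj x : s t / s + t}.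
Proof. exact: tliftD (gtens_proj_bal x). Qed.
Lemma gtens_proj0 x : gtens_proj x 0 = 0.
Proof. exact: tlift0 (gtens_proj_bal x). Qed.

Lemma gtens_proj_hom x y t : t \in gtens_comp y ->
  gtens_proj x t = if x == y then t else 0.
Proof.
move: t; apply: span_ind => [|_ t [g [h [m [n [mg nh <- ->]]]]] IH].
  by rewrite gtens_proj0 if_same.
rewrite gtens_projD IH gtens_projE (bigD1 g) //= big1 => [|k nk]; last first.
  by rewrite (gproj_hom gM _ mg) (negPf nk) [LHS]tens0l.
rewrite (gproj_hom gM _ mg) eqxx (gproj_hom gN _ nh) addr0.
rewrite -(inj_eq (mulgI g)) mulKVg; case: eqP => // _.
by rewrite addr0 [LHS]tens0r.
Qed.

Lemma gtens_proj_mem x t : gtens_proj x t \in gtens_comp x.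
Proof.
elim/btens_ind: t => [|m n t IH]; first by rewrite gtens_proj0; apply: span0.
rewrite gtens_projD spanD // gtens_projE.
elim/big_rec: _ => [|g s _ hs]; first exact: span0.
apply: spanD => //; apply: span_gen.
exists g, (g^-1 * x)%g, (gproj gM g m), (gproj gN (g^-1 * x)%g n).
by rewrite !gproj_mem mulKVg.
Qed.

Lemma gtens_proj_sum t : t = \sum_x gtens_proj x t.
Proof.
elim/btens_ind: t => [|m n t IH].
  by rewrite big1 // => x _; rewrite gtens_proj0.
under eq_bigr => x _ do rewrite gtens_projD gtens_projE.
rewrite big_split /= -IH; congr (_ + _); rewrite exchange_big /=.
transitivity (\sum_g btens (gproj gM g m : bM) n).
  rewrite {1}(gproj_sum gM m).
  exact: (big_morph (fun m => btens (m : bM) n) (fun u v => tensDl _ _ u v n)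
    (tens0l _ _ n)).
apply: eq_bigr => g _; rewrite {1}(gproj_sum gN n) (reindex_inj (mulgI g^-1%g)).
exact: (big_morph (fun n => btens (gproj gM g m : bM) (n : bN))
  (fun u v => tensDr _ _ _ u v) (tens0r _ _ _)).
Qed.

Fact gtens_proof : is_gbimodule gtens_data.
Proof.
split=> [||g x h a t a' ag tx ah|x t c tx] /=.
- exact: (bm_P T).
- split=> [x|t].
    apply: span_zmod => _ [g [h [m [n [mg nh e ->]]]]].
    exists g, h, (- m), n; rewrite (gcompN gM) //; split=> //.
    by rewrite [RHS]tensNl.
  exists [ffun x => gtens_proj x t]; split=> [|F [hF ->]].
    split=> [x|]; first by rewrite ffunE; apply: gtens_proj_mem.
    by rewrite {1}[t]gtens_proj_sum; apply: eq_bigr => x _; rewrite ffunE.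
  apply/ffunP => x; rewrite ffunE.
  rewrite (big_morph _ (gtens_projD x) (gtens_proj0 x)) (bigD1 x) //= big1.
    by rewrite (gtens_proj_hom _ (hF x)) eqxx addr0.
  by move=> y nyx; rewrite (gtens_proj_hom _ (hF y)) eq_sym (negPf nyx).
- move: t tx; apply: span_ind => [|_ t [k [l [m [n [mk nl <- ->]]]]] IH].
    by rewrite btens_l0 btens_r0 span0.
  rewrite btens_lD btens_rD spanD // btens_lE btens_rE; apply: span_gen.
  exists (g * k)%g, (l * h)%g, (gd_l a m), (gd_r n a').
  by rewrite gb_comp_l // gb_comp_r // !mulgA.
- move: t tx; apply: span_ind => [|_ t [k [l [m [n [mk nl <- ->]]]]] IH].
    by rewrite btens_l0 btens_r0.
  rewrite btens_lD btens_rD IH btens_lE btens_rE; congr (_ + _).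
  rewrite /bm_l /bm_r /= (gb_C _ nl) ga_actM -(gb_C _ mk).
  by apply/esym; apply: tens_bal.
Qed.

Definition gtens : gbimodule A A'' := GBimodule gtens_proof.

End GradedTensor.

Definition induce_graded_morita (A A' : cp_over C) (M : gbimodule A A') : Prop :=
  giso (gtens M (gdual M)) (greg A) /\ giso (gtens (gdual M) M) (greg A').

End GradedBimodules.

Arguments gd_comp {O Q C A A'} _ _.
Arguments gd_l {O Q C A A'} {_} _ _.
Arguments gd_r {O Q C A A'} {_} _ _.

Section Diagonal.
Variables (O : comNzRingType) (Q : finGroupType) (C : graded_acted_algebra O Q).

Section CTensor.
Variables A A' : cp_over C.

(* [A (x)_C A'^op]; the tensor products over [C] are formed with the products
   of [A] and of [A'], so that [A'^op] appears as [A'] itself. *)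
Definition ctens : Type := tensor
  (fun (a : A) (c : C) => a * co_map A c) (fun (c : C) (a' : A') => co_map A' c * a').
HB.instance Definition _ := GRing.Zmodule.on ctens.

Definition ct (a : A) (a' : A') : ctens := tens a a'.

Definition ctens_l (x : A) : ctens -> ctens := tlift (fun a a' => ct (x * a) a').
Definition ctens_r (t : ctens) (y : A') : ctens := tlift (fun a a' => ct a (a' * y)) t.

Definition ctens_gen (x : Q) (t : ctens) : Prop :=
  exists g h a a', [/\ a \in cp_comp A g, a' \in cp_comp A' h, (g * h)%g = x
                     & t = ct a a'].

Definition ctens_data : gbimodule_data A A' :=
  @GBimoduleData _ _ _ A A' ctens ctens_l ctens_r (fun x => span (ctens_gen x)).

Lemma ctDl a b a' : ct (a + b) a' = ct a a' + ct b a'.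
Proof. exact: tensDl. Qed.
Lemma ctDr a a' b' : ct a (a' + b') = ct a a' + ct a b'.
Proof. exact: tensDr. Qed.
Lemma ct0l a' : ct 0 a' = 0. Proof. exact: tens0l. Qed.
Lemma ct0r a : ct a 0 = 0. Proof. exact: tens0r. Qed.
Lemma ctNl a a' : ct (- a) a' = - ct a a'. Proof. exact: tensNl. Qed.
Lemma ct_bal a c a' : ct (a * co_map A c) a' = ct a (co_map A' c * a').
Proof. exact: tens_bal. Qed.
Lemma ct_ind (P : ctens -> Prop) :
  P 0 -> (forall a a' t, P t -> P (ct a a' + t)) -> forall t, P t.
Proof. exact: tens_ind. Qed.

Local Notation cbal := (balanced (fun (a : A) (c : C) => a * co_map A c)
  (fun (c : C) (a' : A') => co_map A' c * a')).

Lemma ctens_l_bal x : cbal (fun a a' => ct (x * a) a').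
Proof.
split=> *; first by rewrite mulrDr ctDl.
- by rewrite ctDr.
- by rewrite mulrA ct_bal.
Qed.
Lemma ctens_r_bal y : cbal (fun a a' => ct a (a' * y)).
Proof.
split=> *; first by rewrite ctDl.
- by rewrite mulrDl ctDr.
- by rewrite -mulrA ct_bal.
Qed.
Lemma ctens_lE x a a' : ctens_l x (ct a a') = ct (x * a) a'.
Proof. exact: tliftE (ctens_l_bal x) _ _. Qed.
Lemma ctens_rE a a' y : ctens_r (ct a a') y = ct a (a' * y).
Proof. exact: tliftE (ctens_r_bal y) _ _. Qed.
Lemma ctens_lDr x s t : ctens_l x (s + t) = ctens_l x s + ctens_l x t.
Proof. exact: tliftD (ctens_l_bal x) _ _. Qed.
Lemma ctens_rDl y s t : ctens_r (s + t) y = ctens_r s y + ctens_r t y.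
Proof. exact: tliftD (ctens_r_bal y) _ _. Qed.
Lemma ctens_l0 x : ctens_l x 0 = 0. Proof. exact: tlift0 (ctens_l_bal x). Qed.
Lemma ctens_r0 y : ctens_r 0 y = 0. Proof. exact: tlift0 (ctens_r_bal y). Qed.
Lemma ctens_lDl x y t : ctens_l (x + y) t = ctens_l x t + ctens_l y t.
Proof.
elim/ct_ind: t => [|a a' t IH]; first by rewrite !ctens_l0 addr0.
by rewrite !ctens_lDr IH !ctens_lE mulrDl ctDl addrACA.
Qed.
Lemma ctens_rDr x y t : ctens_r t (x + y) = ctens_r t x + ctens_r t y.
Proof.
elim/ct_ind: t => [|a a' t IH]; first by rewrite !ctens_r0 addr0.
by rewrite !ctens_rDl IH !ctens_rE mulrDr ctDr addrACA.
Qed.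
Lemma ctens_lM x y t : ctens_l (x * y) t = ctens_l x (ctens_l y t).
Proof.
elim/ct_ind: t => [|a a' t IH]; first by rewrite !ctens_l0.
by rewrite !ctens_lDr IH !ctens_lE mulrA.
Qed.
Lemma ctens_rM x y t : ctens_r t (x * y) = ctens_r (ctens_r t x) y.
Proof.
elim/ct_ind: t => [|a a' t IH]; first by rewrite !ctens_r0.
by rewrite !ctens_rDl IH !ctens_rE mulrA.
Qed.
Lemma ctens_lr x y t : ctens_r (ctens_l x t) y = ctens_l x (ctens_r t y).
Proof.
elim/ct_ind: t => [|a a' t IH]; first by rewrite !(ctens_l0, ctens_r0).
by rewrite !(ctens_lDr, ctens_rDl) IH !(ctens_lE, ctens_rE).
Qed.

Definition delta_gen (t : ctens) : Prop :=
  exists g a a', [/\ a \in cp_comp A g, a' \in cp_comp A' g^-1%g & t = ct a a'].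

Definition delta_pred : {pred ctens} := span delta_gen.

Fact delta_zmod_closed : zmod_closed delta_pred.
Proof.
apply: span_zmod => _ [g [a [a' [ag ag' ->]]]].
by exists g, (- a), a'; rewrite (gcompN (cp_grading A)) // ctNl.
Qed.
HB.instance Definition _ := GRing.isZmodClosed.Build ctens delta_pred
  delta_zmod_closed.

(* [Delta (A (x)_C A'^op)] as a ring: [O] acts on it, and on its modules, through
   the multiples of its identity element [1 (x) 1]. *)
Record delta := Delta { delta_val :> ctens; delta_valP : delta_val \in delta_pred }.
HB.instance Definition _ := [isSub for delta_val].
HB.instance Definition _ := [Choice of delta by <:].
HB.instance Definition _ := [SubChoice_isSubZmodule of delta by <:].

(* The right action of [Delta] on [A (x)_C A'^op]:
   [(a (x) a') s = a s a'], that is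
   [(a (x) a') (d (x) d') = a d (x) d' a'], see [ctens_mulE]. *)
Definition ctens_mul (t : ctens) (s : delta) : ctens :=
  tlift (fun a a' => ctens_r (ctens_l a (\val s)) a') t.

Lemma delta_C (t : ctens) c : t \in delta_pred ->
  ctens_l (co_map A c) t = ctens_r t (co_map A' c).
Proof.
move: t; apply: span_ind => [|_ t [g [d [d' [dg dg' ->]]]] IH].
  by rewrite ctens_l0 ctens_r0.
rewrite ctens_lDr ctens_rDl IH ctens_lE ctens_rE; congr (_ + _).
rewrite (co_commute _ (co_mapP A') dg').
have -> : co_map A c = co_map A (ga_act C g (ga_act C g^-1%g c)).
  by rewrite -ga_actM mulgV ga_act1.
by rewrite -(co_commute _ (co_mapP A) dg) ct_bal.
Qed.

Lemma ctens_mul_bal (s : delta) :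
  cbal (fun a a' => ctens_r (ctens_l a (\val s)) a').
Proof.
split=> [a b a'|a a' b'|a c a'].
- by rewrite ctens_lDl ctens_rDl.
- by rewrite ctens_rDr.
- by rewrite ctens_lM ctens_rM ctens_lr delta_C ?(valP s) // !ctens_lr.
Qed.

Lemma ctens_mulC a a' s : ctens_mul (ct a a') s = ctens_r (ctens_l a (\val s)) a'.
Proof. exact: tliftE (ctens_mul_bal s) _ _. Qed.
Lemma ctens_mulDl s : {morph ctens_mul^~ s : t u / t + u}.
Proof. exact: tliftD (ctens_mul_bal s). Qed.
Lemma ctens_mul0l s : ctens_mul 0 s = 0.
Proof. exact: tlift0 (ctens_mul_bal s). Qed.

Lemma ctens_mulE a a' d d' s : \val s = ct d d' ->
  ctens_mul (ct a a') s = ct (a * d) (d' * a').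
Proof. by move=> e; rewrite ctens_mulC e ctens_lE ctens_rE. Qed.

Lemma ctens_mulDr t (s u : delta) :
  ctens_mul t (s + u) = ctens_mul t s + ctens_mul t u.
Proof.
elim/ct_ind: t => [|a a' t IH]; first by rewrite !ctens_mul0l addr0.
by rewrite !ctens_mulDl IH !ctens_mulC /= ctens_lDr ctens_rDl addrACA.
Qed.

Lemma ctens_mul_l x t s : ctens_mul (ctens_l x t) s = ctens_l x (ctens_mul t s).
Proof.
elim/ct_ind: t => [|a a' t IH]; first by rewrite !(ctens_l0, ctens_mul0l).
rewrite !(ctens_lDr, ctens_mulDl) IH ctens_lE !ctens_mulC ctens_lM.
by rewrite ctens_lr.
Qed.

Lemma ctens_mul_r t y s : ctens_mul (ctens_r t y) s = ctens_r (ctens_mul t s) y.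
Proof.
elim/ct_ind: t => [|a a' t IH]; first by rewrite !(ctens_r0, ctens_mul0l).
by rewrite !(ctens_rDl, ctens_mulDl) IH ctens_rE !ctens_mulC ctens_rM.
Qed.

Fact delta_one_proof : ct 1 1 \in delta_pred.
Proof.
apply: span_gen; exists 1%g, 1, 1; rewrite cp_comp1 invg1.
by split=> //; apply: cp_comp1.
Qed.
Definition delta_one : delta := Delta delta_one_proof.

Fact delta_mul_proof (t s : delta) : ctens_mul (\val t) s \in delta_pred.
Proof.
move: (\val t) (valP t); apply: span_ind => [|_ u [g [a [a' [ag ag' ->]]]] IH].
  by rewrite ctens_mul0l; apply: span0.
rewrite ctens_mulDl spanD // ctens_mulC.
move: (\val s) (valP s); apply: span_ind => [|_ r [h [d [d' [dh dh' ->]]]] IHr].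
  by rewrite ctens_l0 ctens_r0 span0.
rewrite ctens_lDr ctens_rDl spanD // ctens_lE ctens_rE; apply: span_gen.
by exists (g * h)%g, (a * d), (d' * a'); rewrite invMg !cp_compM.
Qed.
Definition delta_mul (t s : delta) : delta := Delta (delta_mul_proof t s).

Lemma ctens_mulA (t : ctens) (s r : delta) :
  ctens_mul t (delta_mul s r) = ctens_mul (ctens_mul t s) r.
Proof.
elim/ct_ind: t => [|a a' t IH]; first by rewrite !ctens_mul0l.
by rewrite !ctens_mulDl IH !ctens_mulC ctens_mul_r ctens_mul_l.
Qed.
Lemma ctens_mul1 t : ctens_mul t delta_one = t.
Proof.
elim/ct_ind: t => [|a a' t IH]; first by rewrite !ctens_mul0l.
by rewrite !ctens_mulDl IH (@ctens_mulE a a' 1 1 delta_one) // mulr1 mul1r.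
Qed.

Fact delta_mulA : associative delta_mul.
Proof. by move=> t s r; apply: val_inj; apply: ctens_mulA. Qed.
Fact delta_mul1l : left_id delta_one delta_mul.
Proof.
have h u : ctens_r (ctens_l 1 u) 1 = u.
  elim/ct_ind: u => [|a a' u IH]; first by rewrite ctens_l0 ctens_r0.
  by rewrite ctens_lDr ctens_rDl IH ctens_lE ctens_rE mul1r mulr1.
by move=> t; apply: val_inj; rewrite /= ctens_mulC h.
Qed.
Fact delta_mul1r : right_id delta_one delta_mul.
Proof. by move=> t; apply: val_inj; apply: ctens_mul1. Qed.
Fact delta_mulDl : left_distributive delta_mul +%R.
Proof. by move=> t s r; apply: val_inj; apply: ctens_mulDl. Qed.
Fact delta_mulDr : right_distributive delta_mul +%R.
Proof. by move=> t s r; apply: val_inj; apply: ctens_mulDr. Qed.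
HB.instance Definition _ := GRing.Zmodule_isPzRing.Build delta
  delta_mulA delta_mul1l delta_mul1r delta_mulDl delta_mulDr.

Section Induced.
Variables (M : zmodType) (act : delta -> M -> M).

Definition icar : zmodType := tensor ctens_mul act.
Definition itens (t : ctens) (m : M) : icar := tens t m.
Definition induced_l (x : A) : icar -> icar :=
  tlift (fun t m => itens (ctens_l x t) m).
Definition induced_r (z : icar) (y : A') : icar :=
  tlift (fun t m => itens (ctens_r t y) m) z.
Definition induced_gen (x : Q) (z : icar) : Prop :=
  exists t m, t \in gd_comp ctens_data x /\ z = itens t m.

(* [(A (x)_C A'^op) (x)_Delta M]. *)
Definition induced : gbimodule_data A A' :=
  @GBimoduleData _ _ _ A A' icar induced_l induced_r (fun x => span (induced_gen x)).

Lemma induced_l_bal x :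
  balanced ctens_mul act (fun t m => itens (ctens_l x t) m).
Proof.
split=> *; rewrite /itens; first by rewrite ctens_lDr tensDl.
- by rewrite tensDr.
- by rewrite -ctens_mul_l tens_bal.
Qed.
Lemma induced_r_bal y :
  balanced ctens_mul act (fun t m => itens (ctens_r t y) m).
Proof.
split=> *; rewrite /itens; first by rewrite ctens_rDl tensDl.
- by rewrite tensDr.
- by rewrite -ctens_mul_r tens_bal.
Qed.
Lemma induced_lE x t m : induced_l x (itens t m) = itens (ctens_l x t) m.
Proof. exact: tliftE (induced_l_bal x) _ _. Qed.
Lemma induced_rE t m y : induced_r (itens t m) y = itens (ctens_r t y) m.
Proof. exact: tliftE (induced_r_bal y) _ _. Qed.

End Induced.
End CTensor.

Section Extension.
Variables A A' : cp_over C.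
Local Notation B := (idcomp A).
Local Notation B' := (idcomp A').
Variable M : bimodule B B'.

(* [(x (x) y) m = x m y] for [x] in [B] and [y] in [B']. *)
Definition extends_bimodule (act : delta A A' -> M -> M) : Prop :=
  is_lmodule act /\
  forall (s : delta A A') (x : B) (y : B') m, \val s = ct (\val x) (\val y) ->
    act s m = bm_r M (bm_l M x m) y.

End Extension.

(* [((a' (x) a) f)(m) = u f((u^-1 (x) a') m) a], read in [A]. *)
Definition dual_action_formula (A A' : cp_over C)
    (M : bimodule (idcomp A) (idcomp A')) (act : delta A A' -> M -> M)
    (act' : delta A' A -> dual M -> dual M) : Prop :=
  forall g (a' : A') (a u v : A) (s : delta A' A) (d : delta A A'),
    a' \in cp_comp A' g -> a \in cp_comp A g^-1%g -> u \in cp_comp A g ->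
    u * v = 1 -> v * u = 1 -> \val s = ct a' a -> \val d = ct v a' ->
    forall (f : lhom M) (m : M),
      \val ((act' s f : lhom M) m) = u * \val (f (act d m)) * a.

End Diagonal.

(* Main.v *)
(* Let [u_g] be units of degree [g] of the crossed product [A]. A graded
   [(A, A')]-bimodule [P] over [C] is determined by its component [P_1], as
   [P_g = u_g P_1]. The degree one component of [(A (x)_C A'^op) (x)_Delta M] is
   [M], since the grading of [A (x)_C A'^op] provides a projection onto [Delta].
   A [B]-linear form on [P_1] extends to [P] by [u_g p |-> u_g f(p)], so that
   [P^*_1] is the dual of [P_1]; the degree one component of any graded
   bimodule over [C] is a [Delta]-module through [(a (x) a') p = a p a'], which
   gives the module structure on [M^*] and the description of the dual of the induced bimodule.
   Finally [M] is a progenerator over [B] with [End_B(M) = B'^op]; dual bases and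
   generating families extend from [M] to [P], and for such a [P] the evaluation
   [P (x) P^* -> A] and the pairing [P^* (x) P -> A'] are isomorphisms. *)
Require Import Defs.
From HB Require Import structures.
From mathcomp Require Import all_boot all_order all_fingroup all_algebra.
From mathcomp Require Import boolp functions.

Set Implicit Arguments.
Unset Strict Implicit.
Unset Printing Implicit Defensive.

Import GRing.Theory.
Local Open Scope ring_scope.

(** * Morita bimodules are balanced progenerators *)

(** The first two fields say that [M] is a finitely generated projective generator over [R]; the
    last two say that right multiplication identifies [S] with the opposite of the ring of
    [R]-endomorphisms. The elementwise form is what lifts from a degree one component to a graded
    bimodule. *)
Record balanced_progenerator (O : comNzRingType) (R S : algType O)
    (M : bimodule R S) : Prop := BalancedProgenerator {
  bp_dual_basis : exists s : seq (lhom M * M), forall m,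
    m = \sum_(q <- s) bm_l M (q.1 m) q.2;
  bp_generator : exists s : seq (lhom M * M), 1 = \sum_(q <- s) q.1 q.2;
  bp_faithful : forall c, (forall m, bm_r M m c = 0) -> c = 0;
  bp_full : forall phi : M -> M, (forall x y, phi (x + y) = phi x + phi y) ->
    (forall a x, phi (bm_l M a x) = bm_l M a (phi x)) ->
    exists c, forall m, phi m = bm_r M m c
}.

Section AdditiveMaps.
Variables (V W : zmodType) (f : V -> W).
Hypothesis fD : {morph f : x y / x + y}.

Lemma morph_add0 : f 0 = 0.
Proof. by apply: (addrI (f 0)); rewrite -fD !addr0. Qed.
Lemma morph_addN x : f (- x) = - f x.
Proof. by apply: (addrI (f x)); rewrite -fD !subrr morph_add0. Qed.
Lemma morph_addB x y : f (x - y) = f x - f y.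
Proof. by rewrite fD morph_addN. Qed.
Lemma morph_add_sum (I : Type) (r : seq I) (P : pred I) (F : I -> V) :
  f (\sum_(i <- r | P i) F i) = \sum_(i <- r | P i) f (F i).
Proof. exact: (big_morph f fD morph_add0). Qed.
Lemma morph_add_inj : (forall x, f x = 0 -> x = 0) -> injective f.
Proof.
move=> f0 x y e; apply/eqP; rewrite -subr_eq0; apply/eqP/f0.
by rewrite morph_addB e subrr.
Qed.

End AdditiveMaps.

Section BimoduleZero.
Variables (O : comNzRingType) (R S : algType O) (M : bimodule R S).

Lemma bm_l0 a : bm_l M a 0 = 0.
Proof. by apply: (addrI (bm_l M a 0)); rewrite -bm_lDr !addr0. Qed.
Lemma bm_0l x : bm_l M 0 x = 0.
Proof. by apply: (addrI (bm_l M 0 x)); rewrite -bm_lDl !addr0. Qed.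
Lemma bm_r0 a : bm_r M 0 a = 0.
Proof. by apply: (addrI (bm_r M 0 a)); rewrite -bm_rDl !addr0. Qed.
Lemma bm_0r x : bm_r M x 0 = 0.
Proof. by apply: (addrI (bm_r M x 0)); rewrite -bm_rDr !addr0. Qed.
Lemma bm_l_sum a (I : Type) (r : seq I) (F : I -> M) :
  bm_l M a (\sum_(i <- r) F i) = \sum_(i <- r) bm_l M a (F i).
Proof. exact: (big_morph _ (bm_lDr a) (bm_l0 a)). Qed.
Lemma bm_suml x (I : Type) (r : seq I) (F : I -> R) :
  bm_l M (\sum_(i <- r) F i) x = \sum_(i <- r) bm_l M (F i) x.
Proof. exact: (big_morph (fun a => bm_l M a x) (fun a b => bm_lDl a b x) (bm_0l x)). Qed.
Lemma bm_r_sumr x (I : Type) (r : seq I) (F : I -> S) :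
  bm_r M x (\sum_(i <- r) F i) = \sum_(i <- r) bm_r M x (F i).
Proof. exact: (big_morph (bm_r M x) (fun a b => bm_rDr a b x) (bm_0r x)). Qed.

End BimoduleZero.

(** * Functoriality of the tensor product with a bimodule *)

Section TensorFunctorTheory.
Variables (O : comNzRingType) (R S : algType O) (M : bimodule R S).

Lemma mtensDl (X : lmodType S) m n (x : X) :
  mtens (m + n : M) x = mtens m x + mtens n x.
Proof. exact: tensDl. Qed.
Lemma mtensDr (X : lmodType S) (m : M) (x y : X) :
  mtens m (x + y) = mtens m x + mtens m y.
Proof. exact: tensDr. Qed.
Lemma mtens0l (X : lmodType S) (x : X) : mtens (0 : M) x = 0.
Proof. exact: tens0l. Qed.
Lemma mtens0r (X : lmodType S) (m : M) : mtens m (0 : X) = 0.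
Proof. exact: tens0r. Qed.
Lemma mtensZ (X : lmodType S) a m (x : X) :
  mtens (bm_l M a m) x = a *: mtens m x.
Proof. by rewrite -[RHS]/(mtens_scale a _) mtens_scaleE. Qed.
Lemma mtensC (X : lmodType S) c (m : M) (x : X) :
  mtens (bm_r M m c) x = mtens m (c *: x).
Proof. exact: tens_bal. Qed.

Lemma mtens_mapD (X Y : lmodType S) (f : {linear X -> Y}) :
  forall s t : mtensor M X, mtens_map f (s + t) = mtens_map f s + mtens_map f t.
Proof.
apply: tliftD; split=> *; rewrite /mtens ?linearD ?tensDl ?tensDr //.
by rewrite linearZ tens_bal.
Qed.
Lemma mtens_map0 (X Y : lmodType S) (f : {linear X -> Y}) :
  mtens_map f (0 : mtensor M X) = 0.
Proof. by apply: (addrI (mtens_map f 0)); rewrite -mtens_mapD !addr0. Qed.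
Lemma mtens_mapZ (X Y : lmodType S) (f : {linear X -> Y}) a (t : mtensor M X) :
  mtens_map f (a *: t) = a *: mtens_map f t.
Proof.
elim/mtens_ind: t => [|m x t IH]; first by rewrite !(scaler0, mtens_map0).
rewrite scalerDr !mtens_mapD scalerDr IH; congr (_ + _).
by rewrite -mtensZ !mtens_mapE mtensZ.
Qed.
(** Allows iteration: in [mtens_map (mtens_map f)] the lemmas on the outer map ask for a linear
    inner map. *)
Lemma mtens_map_linear (X Y : lmodType S) (f : {linear X -> Y}) :
  linear (@mtens_map _ _ _ M X Y f).
Proof. by move=> a s t; rewrite mtens_mapD mtens_mapZ. Qed.
HB.instance Definition _ (X Y : lmodType S) (f : {linear X -> Y}) :=
  GRing.isLinear.Build R (mtensor M X) (mtensor M Y) *:%R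
    (@mtens_map _ _ _ M X Y f) (mtens_map_linear f).

End TensorFunctorTheory.

(** * Progenerator properties from two natural isomorphisms *)

Section MoritaProgenerator.
Variables (O : comNzRingType) (R S : algType O) (M : bimodule R S).

(** The map from the regular module sending [1] to [x]. Naturality along these maps reduces every
    module to the regular one. *)
Definition scale_at (T : algType O) (X : lmodType T) (x : X) (a : T^o) : X := a *: x.
Fact scale_at_linear (T : algType O) (X : lmodType T) (x : X) :
  linear (scale_at x).
Proof. by move=> a b c; rewrite /scale_at scalerDl scalerA. Qed.
HB.instance Definition _ (T : algType O) (X : lmodType T) (x : X) :=
  GRing.isLinear.Build T T^o X *:%R (scale_at x) (scale_at_linear x).

Section Evaluation.
Variables (e : forall X : lmodType R, {linear mtensor M (mtensor (dual M) X) -> X}).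
Hypothesis e_bij : forall X, bijective (e X).
Hypothesis e_nat : forall (X Y : lmodType R) (f : {linear X -> Y}) t,
  e Y (mtens_map (mtens_map f) t) = f (e X t).

(** The natural isomorphism [e] is arbitrary, so this form replaces [f] itself: [e] need not be the
    evaluation [m (x) f (x) 1 |-> f m]. *)
Definition eval_form (f : lhom M) (m : M) : R :=
  e R^o (mtens m (mtens (f : dual M) (1 : R^o))).

Fact eval_form_lhom f : eval_form f \in @lhom_pred _ _ _ M.
Proof.
apply/asboolP; split=> [x y|a x]; rewrite /eval_form.
  by rewrite mtensDl linearD.
by rewrite mtensZ linearZ.
Qed.
Definition eval_hom f : lhom M := LHom (eval_form_lhom f).

Lemma eval_homE (X : lmodType R) m (f : lhom M) (x : X) :
  e X (mtens m (mtens (f : dual M) x)) = eval_hom f m *: x.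
Proof.
rewrite -[RHS]/(scale_at x _) -e_nat mtens_mapE.
by rewrite /= mtens_mapE /= /scale_at scale1r.
Qed.

(** Surjectivity of [e] on the regular module: [1] is the image of a sum of tensors [m (x) f (x) x],
    and each of these goes to the value at [m] of the form [eval_hom f] times [x]. *)
Lemma eval_generator : exists s : seq (lhom M * M), 1 = \sum_(q <- s) q.1 q.2.
Proof.
have [e' _ eK] := e_bij R^o.
suff h t : exists s : seq (lhom M * M), e R^o t = \sum_(q <- s) q.1 q.2.
  by have [s hs] := h (e' 1); exists s; rewrite -hs eK.
elim/mtens_ind: t => [|m t u [s hs]]; first by exists [::]; rewrite big_nil linear0.
suff [r hr] : exists r : seq (lhom M * M), e R^o (mtens m t) = \sum_(q <- r) q.1 q.2.
  by exists (r ++ s); rewrite linearD big_cat /= hs hr.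
elim/mtens_ind: t => [|f x t [r hr]].
  by exists [::]; rewrite big_nil mtens0r linear0.
exists ((dual_r (eval_hom f) x, m) :: r).
by rewrite mtensDr linearD big_cons hr eval_homE.
Qed.

Variables (d : forall X : lmodType S, {linear mtensor (dual M) (mtensor M X) -> X}).
Hypothesis d_bij : forall X, bijective (d X).
Hypothesis d_nat : forall (X Y : lmodType S) (f : {linear X -> Y}) t,
  d Y (mtens_map (mtens_map f) t) = f (d X t).

Local Notation X := (mtensor M S^o).
Local Notation T := (mtensor (dual M) X).

(** The canonical isomorphism of [M (x) S] with [M], whose inverse is [m |-> m (x) 1]. *)
Definition unitor : X -> M := tlift (fun m (s : S^o) => bm_r M m s).
Lemma unitor_bal : balanced (bm_r M) (@GRing.scale S S^o) (fun m (s : S^o) => bm_r M m s).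
Proof. by split=> *; rewrite ?bm_rDl ?bm_rDr ?bm_rM. Qed.
Lemma unitorE m s : unitor (mtens m (s : S^o)) = bm_r M m s.
Proof. exact: (tliftE unitor_bal). Qed.
Lemma unitorD : {morph unitor : x y / x + y}.
Proof. exact: (tliftD unitor_bal). Qed.
Lemma unitor0 : unitor 0 = 0.
Proof. exact: (tlift0 unitor_bal). Qed.
Lemma unitorZ a x : unitor (a *: x) = bm_l M a (unitor x).
Proof.
elim/mtens_ind: x => [|m s x IH]; first by rewrite scaler0 unitor0 bm_l0.
by rewrite scalerDr !unitorD bm_lDr IH -mtensZ !unitorE bm_lr.
Qed.
Lemma unitorK x : mtens (unitor x) 1 = x.
Proof.
elim/mtens_ind: x => [|m s x IH]; first by rewrite unitor0 mtens0l.
rewrite unitorD mtensDl IH unitorE mtensC; congr (mtens m _ + _).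
exact: mulr1.
Qed.

Lemma mtens_one m (s : S) : mtens m (s : S^o) = mtens (bm_r M m s) (1 : S^o).
Proof. by rewrite mtensC; congr (mtens m _); rewrite /GRing.scale /= mulr1. Qed.

Lemma map_scale_at c f x :
  mtens_map (mtens_map (scale_at (c : S^o))) (mtens f x : T) =
  mtens f (mtens (bm_r M (unitor x) c) (1 : S^o)).
Proof.
rewrite mtens_mapE /= -[in LHS](unitorK x) mtens_mapE /= /scale_at scale1r.
by rewrite mtens_one.
Qed.

(** If [c] kills [M], the composite functor kills right multiplication by [c] on [S]; naturality at
    the preimage of [1] then gives [c = 0]. *)
Lemma eval_faithful c : (forall m, bm_r M m c = 0) -> c = 0.
Proof.
move=> hc; have [d' _ dK] := d_bij S^o.
have key (t : T) : mtens_map (mtens_map (scale_at (c : S^o))) t = 0.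
  elim/mtens_ind: t => [|f x t IH]; first by rewrite mtens_map0.
  by rewrite mtens_mapD IH addr0 map_scale_at hc mtens0l mtens0r.
have := d_nat (scale_at (c : S^o)) (d' 1).
by rewrite key linear0 dK /= /scale_at scale1r => <-.
Qed.

(** After [M^* (x) -] and [d], the endomorphism [phi] becomes an [S]-linear endomorphism of [S],
    hence right multiplication by some [c]. The difference [n] of [phi m] and [m c] is then killed
    by [M^* (x) -], and the generator property detects that it is zero. *)
Lemma eval_full phi : (forall x y, phi (x + y) = phi x + phi y) ->
    (forall a x, phi (bm_l M a x) = bm_l M a (phi x)) ->
    exists c, forall m, phi m = bm_r M m c.
Proof.
move=> phiD phiZ; have [d' d'K dK] := d_bij S^o.
pose F (x : X) : X := mtens (phi (unitor x)) (1 : S^o).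
have Flin : linear F.
  by move=> a x y; rewrite /F unitorD unitorZ phiD phiZ mtensDl mtensZ.
pose LF : {linear X -> X} := HB.pack F (GRing.isLinear.Build R X X *:%R F Flin).
(* The image of [1] under the endomorphism of [S] induced by [phi]. *)
pose c : S := d S^o (mtens_map LF (d' 1)).
have dF t : d S^o (mtens_map LF t) = (d S^o t : S) * c.
  have -> : t = (d S^o t : S) *: d' 1.
    by apply: (can_inj d'K); rewrite linearZ /= dK /GRing.scale /= mulr1.
  by rewrite mtens_mapZ !linearZ /= dK /GRing.scale /= mulr1.
exists c => m; apply/eqP; rewrite -subr_eq0; apply/eqP.
set n := _ - _.
have n0 f : mtens f (mtens n (1 : S^o)) = 0 :> T.
  rewrite mtensDl mtensDr; apply/eqP.
  have N0 (z : M) : mtens f (mtens (- z) (1 : S^o)) = - mtens f (mtens z (1 : S^o)) :> T.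
    apply: (addrI (mtens f (mtens z (1 : S^o)))); rewrite -mtensDr -mtensDl.
    by rewrite !subrr mtens0l mtens0r.
  rewrite N0 subr_eq0; apply/eqP; apply: (can_inj d'K).
  have := dF (mtens f (mtens m (1 : S^o))).
  rewrite mtens_mapE /= /F unitorE bm_r1 => ->.
  have := d_nat (scale_at (c : S^o)) (mtens f (mtens m (1 : S^o))).
  by rewrite map_scale_at unitorE bm_r1 => ->.
(* The balanced map [g (x) x |-> g(m') x] sends the zero tensor [f (x) n (x) 1] to [f(m') n]. *)
have fn (f : lhom M) m' : bm_l M (f m') n = 0.
  pose h (g : dual M) (x : X) := bm_l M ((g : lhom M) m') (unitor x).
  have hb : balanced (bm_r (dual M)) (@GRing.scale R X) h.
    split=> [g g' x|g x y|g a x]; rewrite /h.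
    - by rewrite lhomDl bm_lDl.
    - by rewrite unitorD bm_lDr.
    - by rewrite unitorZ -bm_lM.
  have := tliftE hb (f : dual M) (mtens n (1 : S^o)).
  rewrite -[tens _ _]/(mtens (f : dual M) (mtens n (1 : S^o))) n0 (tlift0 hb).
  by rewrite /h unitorE bm_r1.
have [s hs] := eval_generator.
by rewrite -[n](@bm_l1 _ _ _ M) hs bm_suml big1.
Qed.

(* The bijections [M -> M (x) S -> M (x) (M^* (x) M) -> M] compose to a map
   [theta m = \sum_j f_j(m) x_j]; a dual basis is given by the [f_j] and the
   [theta^-1 x_j]. *)
Lemma eval_dual_basis : exists s : seq (lhom M * M), forall m,
  m = \sum_(q <- s) bm_l M (q.1 m) q.2.
Proof.
have [d' d'K dK] := d_bij S^o; have [eX eXK KeX] := e_bij X.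
pose t1 : T := d' 1.
have t1E t : t = (d S^o t : S) *: t1.
  by apply: (can_inj d'K); rewrite linearZ /= dK /GRing.scale /= mulr1.
have [s hs] : exists s : seq (lhom M * M),
    forall m, unitor (e X (mtens m t1)) = \sum_(q <- s) bm_l M (q.1 m) q.2.
  elim/mtens_ind: (t1) => [|f x t [s hs]].
    by exists [::] => m; rewrite big_nil mtens0r linear0 unitor0.
  exists ((eval_hom f, unitor x) :: s) => m.
  by rewrite big_cons mtensDr linearD unitorD hs eval_homE unitorZ.
pose theta m := unitor (e X (mtens m t1)).
have thetaD x y : theta (x + y) = theta x + theta y.
  by rewrite /theta mtensDl linearD unitorD.
have thetaZ a x : theta (bm_l M a x) = bm_l M a (theta x).
  by rewrite /theta mtensZ linearZ unitorZ.
(* As [T] is generated by [t1] over [S], every element of [M (x) T] has the form [m' (x) t1]. *)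
have theta_surj m : exists m', theta m' = m.
  have [m' hm'] : exists m', eX (mtens m (1 : S^o)) = mtens m' t1.
    elim/mtens_ind: (eX _) => [|u t w [m' ->]]; first by exists 0; rewrite mtens0l.
    by exists (bm_r M u (d S^o t) + m'); rewrite mtensDl mtensC -t1E.
  by exists m'; rewrite /theta -hm' KeX unitorE bm_r1.
(* The balanced map [x (x) t |-> x d(t)] sends [m (x) t1] back to [m], since [d] sends [t1] to
   [1]. *)
have theta_inj m : theta m = 0 -> m = 0.
  rewrite /theta => h; have e0 : e X (mtens m t1) = 0.
    by rewrite -[LHS]unitorK h mtens0l.
  have t0 : mtens m t1 = 0 by rewrite -[LHS]eXK e0 -(linear0 (e X)) eXK.
  pose k (x : M) (t : T) := bm_r M x (d S^o t).
  have kb : balanced (bm_r M) (@GRing.scale S T) k.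
    split=> [x y t|x t u|x a t]; rewrite /k; first by rewrite bm_rDl.
    - by rewrite linearD bm_rDr.
    - by rewrite linearZ bm_rM.
  have := tliftE kb m t1; rewrite -[tens _ _]/(mtens m t1) t0 (tlift0 kb).
  by rewrite /k dK bm_r1.
have [th thK] : exists th, cancel th theta.
  by exists (fun m => sval (cid (theta_surj m))) => m; case: (cid _).
exists [seq (q.1, th q.2) | q <- s] => m.
apply: (morph_add_inj thetaD theta_inj); rewrite (morph_add_sum thetaD) big_map.
by rewrite [LHS]hs; apply: eq_bigr => q _; rewrite thetaZ thK.
Qed.

End Evaluation.

Lemma morita_progenerator : induce_morita M (dual M) -> balanced_progenerator M.
Proof.
move=> [[d [d_bij d_nat]] [e [e_bij e_nat]]]; split.
- exact: (eval_dual_basis e_bij e_nat d_bij).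
- exact: (eval_generator e_bij e_nat).
- exact: (eval_faithful d_bij d_nat).
- exact: (eval_full e_bij e_nat d_bij d_nat).
Qed.

End MoritaProgenerator.

(** * Graded bimodules and their degree one components *)

Section Units.
Variables (O : comNzRingType) (Q : finGroupType) (A : crossed_product O Q).

Definition cpu (g : Q) : A := sval (cid (cp_unit A g)).
Definition cpv (g : Q) : A := sval (cid (svalP (cid (cp_unit A g)))).

Lemma cpuvP g : [/\ cpu g \in cp_comp A g, cpv g \in cp_comp A g^-1%g,
  cpu g * cpv g = 1 & cpv g * cpu g = 1].
Proof. exact: (svalP (cid (svalP (cid (cp_unit A g))))). Qed.
Lemma cpu_comp g : cpu g \in cp_comp A g. Proof. by case: (cpuvP g). Qed.
Lemma cpv_comp g : cpv g \in cp_comp A g^-1%g. Proof. by case: (cpuvP g). Qed.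
Lemma cpuK g : cpu g * cpv g = 1. Proof. by case: (cpuvP g). Qed.
Lemma cpvK g : cpv g * cpu g = 1. Proof. by case: (cpuvP g). Qed.

Lemma idcomp_of (x : A) : x \in cp_comp A 1%g -> exists y : idcomp A, \val y = x.
Proof. by move=> hx; exists (IdComp hx). Qed.

Lemma idcomp_valD (x y : idcomp A) : \val (x + y) = \val x + \val y.
Proof. by []. Qed.
Lemma idcomp_valM (x y : idcomp A) : \val (x * y) = \val x * \val y.
Proof. by []. Qed.

End Units.

Section GradedBimoduleTheory.
Variables (O : comNzRingType) (Q : finGroupType) (C : graded_acted_algebra O Q).
Variables (A A' : cp_over C) (P : gbimodule A A').
Local Notation bP := (gb_bimodule P).
Let gP := gb_grading P.
Let gA' := cp_grading A'.

Lemma gb_lM a b (p : P) : gd_l (a * b) p = gd_l a (gd_l b p).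
Proof. exact: (@bm_lM _ _ _ bP). Qed.
Lemma gb_l1 (p : P) : gd_l 1 p = p.
Proof. exact: (@bm_l1 _ _ _ bP). Qed.
Lemma gb_rM a b (p : P) : gd_r p (a * b) = gd_r (gd_r p a) b.
Proof. exact: (@bm_rM _ _ _ bP). Qed.
Lemma gb_r1 (p : P) : gd_r p 1 = p.
Proof. exact: (@bm_r1 _ _ _ bP). Qed.
Lemma gb_lr a (p : P) b : gd_r (gd_l a p) b = gd_l a (gd_r p b).
Proof. exact: (@bm_lr _ _ _ bP). Qed.

Lemma gb_cpuK g (p : P) : gd_l (cpu A g) (gd_l (cpv A g) p) = p.
Proof. by rewrite -gb_lM cpuK gb_l1. Qed.

Lemma gb_cpv_comp g (p : P) : p \in gd_comp P g -> gd_l (cpv A g) p \in gd_comp P 1%g.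
Proof. by move=> pg; rewrite -(mulVg g); apply: gb_comp_l (cpv_comp A g) pg. Qed.

(** Companion of [gproj_r]: here the module element is homogeneous and the scalar arbitrary, so
    components of [c] are read off from those of [p c]. *)
Lemma gproj_r_hom g x (p : P) c : p \in gd_comp P g ->
  gproj gP x (gd_r p c) = gd_r p (gproj gA' (g^-1 * x)%g c).
Proof.
move=> pg; rewrite (@gproj_uniq _ _ _ _ _
  [ffun h => gd_r p (gproj gA' (g^-1 * h)%g c)]) ?ffunE //.
split=> [h|].
  by rewrite ffunE -{2}(mulKVg g h); apply: gb_comp_r pg; apply: gproj_mem.
rewrite {1}(gproj_sum gA' c) (morph_add_sum (fun a b => gb_rDr a b p)).
by rewrite (reindex_inj (mulgI g^-1%g)) /=; apply: eq_bigr => h _; rewrite ffunE.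
Qed.

End GradedBimoduleTheory.

(** * Recognising isomorphisms of graded bimodules *)

Section GradedIsomorphisms.
Variables (O : comNzRingType) (Q : finGroupType) (C : graded_acted_algebra O Q).
Variables A A' : cp_over C.

Lemma giso_sym (P P' : gbimodule A A') : giso P P' -> giso P' P.
Proof.
case=> f [[f' fK f'K] fD fl fr fg]; exists f'; split.
- by exists f.
- by move=> x y; rewrite -{1}(f'K x) -{1}(f'K y) -fD fK.
- by move=> a x; rewrite -{1}(f'K x) -fl fK.
- by move=> x a; rewrite -{1}(f'K x) -fr fK.
- by move=> g x; rewrite -fg f'K.
Qed.

Section GradedMorphism.
Variables (P P' : gbimodule A A') (f : P -> P').
Hypotheses (fD : {morph f : x y / x + y})
  (fl : forall a x, f (gd_l a x) = gd_l a (f x))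
  (fr : forall x a, f (gd_r x a) = gd_r (f x) a)
  (fg : forall g x, x \in gd_comp P g -> f x \in gd_comp P' g).

Lemma gproj_morph g x :
  gproj (gb_grading P') g (f x) = f (gproj (gb_grading P) g x).
Proof.
rewrite (@gproj_uniq _ _ _ _ _ [ffun h => f (gproj (gb_grading P) h x)]) ?ffunE //.
split=> [h|]; first by rewrite ffunE fg ?gproj_mem.
rewrite {1}(gproj_sum (gb_grading P) x) (morph_add_sum fD).
by apply: eq_bigr => h _; rewrite ffunE.
Qed.

(** Degrees are also reflected: [f] commutes with the projections, so if [f x] has degree [g], then
    [x] and its component of degree [g] have the same image. *)
Lemma giso_of_bijective : bijective f -> giso P P'.
Proof.
move=> fbij; exists f; split=> // g x; apply/idP/idP => [fx|]; last exact: fg.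
suff -> : x = gproj (gb_grading P) g x by apply: gproj_mem.
apply: (bij_inj fbij); rewrite -gproj_morph.
by rewrite (gproj_hom (gb_grading P') _ fx) eqxx.
Qed.

(* The components of [P] and [P'] are the translates of the degree one ones by
   the units of [A]. *)
Lemma giso_of_degree_one :
  (forall x, x \in gd_comp P 1%g -> f x = 0 -> x = 0) ->
  (forall y, y \in gd_comp P' 1%g -> exists x, f x = y) -> giso P P'.
Proof.
move=> finj fsurj.
apply: giso_of_bijective.
have inj : injective f.
  apply: (morph_add_inj fD) => x fx0.
  rewrite (gproj_sum (gb_grading P) x) big1 // => g _.
  rewrite -[LHS](gb_cpuK g) (finj (gd_l (cpv A g) _)) ?gb_l0 //.
    by apply: gb_cpv_comp; apply: gproj_mem.
  by rewrite fl -gproj_morph fx0 gproj0 gb_l0.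
have surj y : exists x, f x = y.
  have h g : exists x, f x = gproj (gb_grading P') g y.
    have [x hx] := fsurj _ (gb_cpv_comp (gproj_mem (gb_grading P') g y)).
    by exists (gd_l (cpu A g) x); rewrite fl hx gb_cpuK.
  have [F hF] := choice h.
  exists (\sum_g F g); rewrite (morph_add_sum fD) [RHS](gproj_sum (gb_grading P')).
  by apply: eq_bigr.
have [f' f'K] := choice surj.
by exists f' => // x; apply: inj; rewrite f'K.
Qed.

End GradedMorphism.

End GradedIsomorphisms.

(** * Extension from the degree one component *)

Section DegreeOnePart.
Variables (O : comNzRingType) (Q : finGroupType) (C : graded_acted_algebra O Q).

(** An isomorphism of bimodules over the identity components from [M] onto the degree one component
    of [P]. Stated through [j], it lets a given [M] play that role without being a subtype of
    [P]. *)
Record degree_one_part (A A' : cp_over C) (P : gbimodule A A')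
    (M : bimodule (idcomp A) (idcomp A')) (j : M -> P) : Prop := DegreeOnePart {
  d1_D : {morph j : x y / x + y};
  d1_eq0 : forall m, j m = 0 -> m = 0;
  d1_mem : forall m, j m \in gd_comp P 1%g;
  d1_surj : forall p, p \in gd_comp P 1%g -> exists m, j m = p;
  d1_l : forall x m, j (bm_l M x m) = gd_l (\val x) (j m);
  d1_r : forall m y, j (bm_r M m y) = gd_r (j m) (\val y)
}.

Variables (A A' : cp_over C) (P : gbimodule A A').
Variables (M : bimodule (idcomp A) (idcomp A')) (j : M -> P).
Hypothesis jP : degree_one_part j.
Local Notation bP := (gb_bimodule P).
Let gP := gb_grading P.
Let gA' := cp_grading A'.

Lemma d1_inj : injective j.
Proof. exact: morph_add_inj (d1_D jP) (d1_eq0 jP). Qed.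

(** Made total by the default value [0]; it is applied only to elements of degree one. *)
Definition d1_inv (p : P) : M :=
  if pselect (exists m, j m = p) is left h then sval (cid h) else 0.

Lemma d1_invK p : p \in gd_comp P 1%g -> j (d1_inv p) = p.
Proof.
move=> /(d1_surj jP) h; rewrite /d1_inv; case: pselect => // h'.
exact: svalP (cid h').
Qed.

(** An element [p] of degree [g] is [u_g (u_g^-1 p)] with [u_g^-1 p] in the image of [j], so that
    image generates [P] over [A]. *)
Lemma d1_ext (V : zmodType) (F G : P -> V) :
  {morph F : x y / x + y} -> {morph G : x y / x + y} ->
  (forall a m, F (gd_l a (j m)) = G (gd_l a (j m))) -> F =1 G.
Proof.
move=> FD GD FG; apply: (hom_ext gP FD GD) => g p pg.
by rewrite -(gb_cpuK g p) -(d1_invK (gb_cpv_comp pg)) FG.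
Qed.

Section Extension.
Variable f : lhom M.

Definition d1_ext_fun (p : bP) : A :=
  \sum_g cpu A g * \val (f (d1_inv (gd_l (cpv A g) (gproj gP g p)))).

Lemma d1_ext_funD : {morph d1_ext_fun : p q / p + q}.
Proof.
move=> p q; rewrite -big_split; apply: eq_bigr => g _ /=.
rewrite -mulrDr -idcomp_valD -lhomDr; congr (_ * \val (f _)).
apply: d1_inj; rewrite (d1_D jP) !d1_invK ?gb_cpv_comp ?gproj_mem //.
by rewrite gprojD gb_lDr.
Qed.

Fact d1_ext_lhom : d1_ext_fun \in @lhom_pred _ _ _ bP.
Proof.
apply/asboolP; split=> [|a p]; first exact: d1_ext_funD.
apply: (@hom_ext _ _ _ _ (cp_grading A) (fun a => d1_ext_fun (gd_l a p))
  (fun a => a * d1_ext_fun p)) => [b c|b c|k {}a ak].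
- by rewrite gb_lDl d1_ext_funD.
- by rewrite mulrDl.
rewrite /d1_ext_fun mulr_sumr (reindex_inj (mulgI k)); apply: eq_bigr => g _ /=.
rewrite (gproj_l _ _ ak) mulKg; set q := gproj _ _ _.
have qg : q \in gd_comp P g by apply: gproj_mem.
(* For [a] of degree [k], one has [a u_g = u_kg x] with [x] in the identity component, and the
   linearity of [f] extracts [x]. *)
have [x hx] : exists x : idcomp A, \val x = cpv A (k * g)%g * (a * cpu A g).
  by apply: idcomp_of; rewrite -(mulVg (k * g)%g); rewrite !cp_compM ?cpu_comp ?cpv_comp.
have -> : d1_inv (gd_l (cpv A (k * g)%g) (gd_l a q)) =
    bm_l M x (d1_inv (gd_l (cpv A g) q)).
  apply: d1_inj; rewrite (d1_l jP) hx !d1_invK ?gb_cpv_comp ?gb_comp_l //.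
  by rewrite !gb_lM gb_cpuK.
rewrite lhomZ idcomp_valM hx !mulrA cpuK mul1r.
by rewrite -!mulrA.
Qed.

Definition d1_lift : lhom bP := LHom d1_ext_lhom.

Lemma d1_liftE m : d1_lift (j m) = \val (f m).
Proof.
rewrite /= /d1_ext_fun (bigD1 1%g) //= big1 ?addr0 => [|g ng].
  rewrite (gproj_hom gP _ (d1_mem jP m)) eqxx.
  (* The unit chosen in degree one need not be [1], but its inverse lies in the identity component,
     over which [f] is linear. *)
  have [x hx] : exists x : idcomp A, \val x = cpv A 1%g.
    by apply: idcomp_of; rewrite -{2}(invg1 Q) cpv_comp.
  have -> : d1_inv (gd_l (cpv A 1%g) (j m)) = bm_l M x m.
    apply: d1_inj; rewrite d1_invK ?(d1_l jP) ?hx //.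
    by apply: gb_cpv_comp; apply: (d1_mem jP).
  by rewrite lhomZ idcomp_valM hx mulrA cpuK mul1r.
rewrite (gproj_hom gP _ (d1_mem jP m)) (negPf ng) gb_l0.
have -> : d1_inv 0 = 0.
  by apply: d1_inj; rewrite d1_invK ?(gcomp0 gP) // (morph_add0 (d1_D jP)).
by rewrite lhom0r mulr0.
Qed.

Lemma d1_lift_comp : (d1_lift : dual bP) \in gdual_comp 1%g.
Proof.
apply/asboolP => g p pg; rewrite -(gb_cpuK g p) -(d1_invK (gb_cpv_comp pg)).
rewrite gb_lhomZ d1_liftE; apply: cp_compM; first exact: cpu_comp.
exact: idcomp_valP.
Qed.

End Extension.

Lemma lhom_d1P (F G : lhom bP) : (forall m, F (j m) = G (j m)) -> F = G.
Proof.
move=> FG; apply: lhomP; apply: d1_ext => [x y|x y|a m]; rewrite ?lhomDr //.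
by rewrite !gb_lhomZ FG.
Qed.

Lemma dual_degree_one_part :
  @degree_one_part A' A (gdual P) (dual M) (fun f => d1_lift f).
Proof.
split=> [f g|f|f|F|s f|f a].
- by apply: lhom_d1P => m; rewrite lhomDl !d1_liftE.
- move=> f0; apply: lhomP => m; apply: val_inj; rewrite -d1_liftE.
  by rewrite [X in lhom_fun X]f0.
- exact: d1_lift_comp.
- move=> /asboolP F1.
  (* A form of degree one maps the degree one component of [P] into that of [A], so it restricts
     along [j] to a form on [M]. *)
  have Fj m : exists x : idcomp A, \val x = (F : lhom _) (j m).
    by apply: idcomp_of; rewrite -(mulg1 1%g); apply: F1; apply: (d1_mem jP).
  have [f hf] := choice Fj.
  have fP : f \in @lhom_pred _ _ _ M.
    apply/asboolP; split=> [x y|a x]; apply: val_inj; rewrite /= hf.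
      by rewrite (d1_D jP) lhomDr -!hf.
    by rewrite (d1_l jP) gb_lhomZ -hf.
  by exists (LHom fP : dual M); apply: lhom_d1P => m; rewrite d1_liftE hf.
- apply: lhom_d1P => m; rewrite d1_liftE /=.
  by rewrite -[RHS]/(d1_lift f (gd_r (j m) (\val s))) -(d1_r jP) d1_liftE.
- apply: lhom_d1P => m; rewrite d1_liftE /=.
  by rewrite -[RHS]/(d1_lift f (j m) * \val a) d1_liftE.
Qed.

Lemma degree_one_progenerator :
  balanced_progenerator M -> balanced_progenerator bP.
Proof.
case=> [[s hs] [r hr] faith full]; split.
- exists [seq (d1_lift q.1, j q.2) | q <- s]; apply: d1_ext => // [x y|a m].
    rewrite -big_split; apply: eq_bigr => q _.
    by rewrite [X in bm_l _ X](lhomDr q.1 x y); apply: gb_lDl.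
  transitivity (bm_l bP a (\sum_(q <- s) bm_l bP (\val (q.1 m)) (j q.2))).
    rewrite {1}(hs m) (morph_add_sum (d1_D jP)); congr (bm_l bP a _).
    by apply: eq_bigr => q _; rewrite (d1_l jP).
  rewrite bm_l_sum big_map; apply: eq_bigr => q _.
  by rewrite gb_lhomZ d1_liftE bm_lM.
- exists [seq (d1_lift q.1, j q.2) | q <- r].
  rewrite big_map; under eq_bigr => q _ do rewrite d1_liftE.
  rewrite -[LHS]/(\val (1 : idcomp A)) hr.
  exact: (raddf_sum (\val : idcomp A -> A)).
- move=> c hc; rewrite (gproj_sum gA' c) big1 // => h _.
  (* Each component of [c] is moved to degree one by a unit, where the faithfulness of [M]
     applies. *)
  have [y hy] : exists y : idcomp A', \val y = gproj gA' h c * cpv A' h.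
    by apply: idcomp_of; rewrite -(mulgV h) cp_compM ?cpv_comp ?gproj_mem.
  suff y0 : y = 0 by rewrite -[LHS]mulr1 -(cpvK A' h) mulrA -hy y0 mul0r.
  apply: faith => m; apply: (d1_eq0 jP); rewrite (d1_r jP) hy gb_rM.
  have := gproj_r_hom h c (d1_mem jP m).
  by rewrite invg1 mul1g => <-; rewrite [gd_r _ c]hc gproj0 gb_r0.
- move=> phi phiD phiZ.
  (* The component of degree [h] of [phi (j m)], times [u_h^-1] on the right, defines an
     endomorphism of [M], hence a right multiplication by some [y]. *)
  have phih h : exists y : idcomp A', forall m,
      gd_r (gproj gP h (phi (j m))) (cpv A' h) = gd_r (j m) (\val y).
    pose psi m := d1_inv (gd_r (gproj gP h (phi (j m))) (cpv A' h)).
    have psiK m : j (psi m) = gd_r (gproj gP h (phi (j m))) (cpv A' h).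
      by rewrite d1_invK // -(mulgV h) gb_comp_r ?cpv_comp ?gproj_mem.
    have [m m'|x m|y hy] := full psi.
    + apply: d1_inj; rewrite (d1_D jP) !psiK (d1_D jP) phiD gprojD.
      exact: gb_rDl.
    + apply: d1_inj; rewrite (d1_l jP) !psiK (d1_l jP) phiZ.
      rewrite (gproj_l _ _ (idcomp_valP x)) invg1 mul1g.
      exact: gb_lr.
    + by exists y => m; rewrite -(d1_r jP) -hy psiK.
  have [y hy] := choice phih.
  (* Undoing the shifts by the [u_h^-1] and summing over the degrees. *)
  exists (\sum_h \val (y h) * cpu A' h); apply: d1_ext => // [u v|a m].
    exact: bm_rDl.
  rewrite [gd_l _ _]/(bm_l bP a (j m)) phiZ bm_lr; congr (bm_l bP a _).
  rewrite bm_r_sumr {1}(gproj_sum gP (phi _)); apply: eq_bigr => h _.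
  rewrite bm_rM; have -> : bm_r bP (j m) (\val (y h)) =
      gd_r (gproj gP h (phi (j m))) (cpv A' h) by rewrite hy.
  by rewrite -[RHS](@bm_rM _ _ _ bP (cpv A' h) (cpu A' h)) cpvK bm_r1.
Qed.

End DegreeOnePart.

(** * Graded Morita equivalences *)

Section TensorBimoduleTheory.
Variables (O : comNzRingType) (R S T : algType O).
Variables (M : bimodule R S) (N : bimodule S T).

Lemma btensDl m m' (n : N) :
  btens (m + m' : M) n = btens m n + btens m' n.
Proof. exact: tensDl. Qed.
Lemma btensDr (m : M) (n n' : N) :
  btens m (n + n') = btens m n + btens m n'.
Proof. exact: tensDr. Qed.
Lemma btens_bal (m : M) s (n : N) :
  btens (bm_r M m s) n = btens m (bm_l N s n).
Proof. exact: tens_bal. Qed.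
Lemma btens_suml
  (I : Type) (r : seq I) (F : I -> M) (n : N) :
  btens (\sum_(i <- r) F i) n = \sum_(i <- r) btens (F i) n.
Proof.
exact: (morph_add_sum (f := fun m => btens m n) (fun a b => btensDl a b n)).
Qed.
Lemma btens_sumr
  (I : Type) (r : seq I) (F : I -> N) (m : M) :
  btens m (\sum_(i <- r) F i) = \sum_(i <- r) btens m (F i).
Proof. exact: (morph_add_sum (btensDr m)). Qed.

End TensorBimoduleTheory.

(** * The Morita context of a graded progenerator *)

Section GradedMorita.
Variables (O : comNzRingType) (Q : finGroupType) (C : graded_acted_algebra O Q).
Variables (A A' : cp_over C) (P : gbimodule A A').
Local Notation bP := (gb_bimodule P).
Local Notation D := (dual bP).
Let gP := gb_grading P.
Let gA' := cp_grading A'.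

Definition eval_map : tens_bimodule bP D -> A := tlift (fun p (f : D) => (f : lhom bP) p).

Lemma eval_map_bal :
  balanced (bm_r bP) (bm_l D) (fun p (f : D) => (f : lhom bP) p).
Proof. by split=> // *; apply: lhomDr. Qed.
Lemma eval_mapE p (f : D) : eval_map (btens p f) = (f : lhom bP) p.
Proof. exact: tliftE eval_map_bal _ _. Qed.
Lemma eval_mapD : {morph eval_map : s t / s + t}.
Proof. exact: tliftD eval_map_bal. Qed.
Lemma eval_map0 : eval_map 0 = 0.
Proof. exact: tlift0 eval_map_bal. Qed.

Hypothesis hP : balanced_progenerator bP.

Fact pairing_ex (f : D) (p : bP) : exists c, forall q : bP,
  bm_l bP ((f : lhom bP) q) p = bm_r bP q c.
Proof.
have [_ _ _ full] := hP; apply: full => [x y|a x].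
  by rewrite lhomDr bm_lDl.
by rewrite lhomZ bm_lM.
Qed.

(* The element [(f, p)] of [A'] with [q (f, p) = f(q) p]. *)
Definition pairing (f : D) (p : bP) : A' := sval (cid (pairing_ex f p)).

Lemma pairingP f p q : bm_r bP q (pairing f p) = bm_l bP ((f : lhom bP) q) p.
Proof. by rewrite /pairing; case: (cid _). Qed.

(** The pairing is known only through its action on [P]; faithfulness turns identities there into
    identities in [A']. *)
Lemma bp_ext c d : (forall q, bm_r bP q c = bm_r bP q d) -> c = d.
Proof.
move=> e; apply/eqP; rewrite -subr_eq0; apply/eqP/(bp_faithful hP) => q.
have h := morph_addN (fun a b => bm_rDr (M := bP) a b q) d.
by rewrite bm_rDr e h subrr.
Qed.

Lemma pairing_bal : balanced (bm_r D) (bm_l bP) pairing.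
Proof.
split=> [f g p|f p p'|f a p]; apply: bp_ext => q.
- by rewrite bm_rDr !pairingP lhomDl bm_lDl.
- by rewrite bm_rDr !pairingP bm_lDr.
- by rewrite !pairingP /= -[RHS]bm_lM.
Qed.

Lemma pairing_l c (f : D) p : pairing (bm_l D c f) p = c * pairing f p.
Proof. by apply: bp_ext => q; rewrite bm_rM !pairingP. Qed.
Lemma pairing_r c (f : D) p : pairing f (bm_r bP p c) = pairing f p * c.
Proof. by apply: bp_ext => q; rewrite bm_rM !pairingP bm_lr. Qed.

(** The second associativity law [(f, p) h = f h(p)] of the Morita context, the first being
    [pairingP]. *)
Lemma dual_pairing (f h : D) p :
  bm_l D (pairing f p) h = bm_r D f ((h : lhom bP) p).
Proof.
apply: lhomP => q; rewrite -[LHS]/((h : lhom bP) (bm_r bP q (pairing f p))).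
by rewrite pairingP lhomZ.
Qed.

Definition pairing_map : tens_bimodule D bP -> A' := tlift pairing.
Lemma pairing_mapE f p : pairing_map (btens f p) = pairing f p.
Proof. exact: tliftE pairing_bal _ _. Qed.
Lemma pairing_mapD : {morph pairing_map : s t / s + t}.
Proof. exact: tliftD pairing_bal. Qed.
Lemma pairing_map0 : pairing_map 0 = 0.
Proof. exact: tlift0 pairing_bal. Qed.

(** For [q] of degree [g], the element [q (f, p) = f(q) p] has degree [g x y], so [q] sees only the
    component of degree [x y] of the pairing. *)
Lemma pairing_comp x y (f : D) (p : P) :
  f \in gdual_comp x -> p \in gd_comp P y -> pairing f p \in cp_comp A' (x * y)%g.
Proof.
move=> /asboolP fx py; set c := pairing f p.
suff -> : c = gproj gA' (x * y)%g c by apply: gproj_mem.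
apply: bp_ext; apply: (hom_ext gP) => [u v|u v|g q qg]; rewrite ?bm_rDl //.
have := pairingP f p q; rewrite -/c => e.
have h : gd_r q c \in gd_comp P (g * (x * y))%g.
  by rewrite [gd_r q c]e mulgA; apply: gb_comp_l py; apply: fx.
have := gproj_r_hom (g * (x * y)) c qg; rewrite mulKg.
by rewrite (gproj_hom (gb_grading P) _ h) eqxx.
Qed.

Lemma eval_giso : giso (gtens P (gdual P)) (greg A).
Proof.
have [_ [s hs] _ _] := hP.
apply: (@giso_of_bijective _ _ _ _ _ (gtens P (gdual P)) (greg A) eval_map).
- exact: eval_mapD.
- move=> a t; rewrite /= -[RHS]/(a * eval_map t).
  elim/btens_ind: t => [|p f t IH]; first by rewrite btens_l0 eval_map0 mulr0.
  by rewrite btens_lD !eval_mapD mulrDr IH btens_lE !eval_mapE lhomZ.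
- move=> t a; rewrite /= -[RHS]/(eval_map t * a).
  elim/btens_ind: t => [|p f t IH]; first by rewrite btens_r0 eval_map0 mul0r.
  by rewrite btens_rD !eval_mapD mulrDl IH btens_rE !eval_mapE.
- move=> x; apply: Defs.span_ind => [|_ t [g [h [m [n [mg /asboolP nh <- ->]]]]] IH].
    by rewrite eval_map0; apply: gcomp0 (cp_grading A) _.
  rewrite eval_mapD; apply: (gcompD (cp_grading A)) => //.
  by rewrite eval_mapE; apply: nh.
(* With [1 = \sum_i f_i(x_i)], the inverse is [a |-> \sum_i a x_i (x) f_i]. *)
pose inv (a : A) : tens_bimodule bP D := \sum_(q <- s) btens (bm_l bP a q.2) (q.1 : D).
have invD : {morph inv : a b / a + b}.
  move=> a b; rewrite -big_split; apply: eq_bigr => q _.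
  by rewrite bm_lDl btensDl.
exists inv => [t|a].
  elim/btens_ind: t => [|p f t IH]; first by rewrite eval_map0 (morph_add0 invD).
  rewrite eval_mapD invD IH eval_mapE; congr (_ + _).
  (* Since [f(p) x_i = p (f, x_i)], the pairing crosses the tensor sign; [dual_pairing] then gives
     [\sum_i f f_i(x_i) = f]. *)
  transitivity (btens p (\sum_(q <- s) bm_l D (pairing f q.2) (q.1 : D))).
    rewrite btens_sumr; apply: eq_bigr => q _.
    by rewrite -btens_bal pairingP.
  congr (btens p _); under eq_bigr => q _ do rewrite dual_pairing.
  rewrite -[RHS](@bm_r1 _ _ _ D) hs.
  by rewrite (morph_add_sum (fun a b => bm_rDr (M := D) a b f)).
rewrite (morph_add_sum eval_mapD); under eq_bigr => q _ do rewrite eval_mapE lhomZ.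
by rewrite -mulr_sumr -hs mulr1.
Qed.

Lemma pairing_giso : giso (gtens (gdual P) P) (greg A').
Proof.
have [[s hs] _ _ _] := hP.
apply: (@giso_of_bijective _ _ _ _ _ (gtens (gdual P) P) (greg A') pairing_map).
- exact: pairing_mapD.
- move=> a t; rewrite /= -[RHS]/(a * pairing_map t).
  elim/btens_ind: t => [|p f t IH]; first by rewrite btens_l0 pairing_map0 mulr0.
  by rewrite btens_lD !pairing_mapD mulrDr IH btens_lE !pairing_mapE pairing_l.
- move=> t a; rewrite /= -[RHS]/(pairing_map t * a).
  elim/btens_ind: t => [|p f t IH]; first by rewrite btens_r0 pairing_map0 mul0r.
  by rewrite btens_rD !pairing_mapD mulrDl IH btens_rE !pairing_mapE pairing_r.
- move=> x; apply: Defs.span_ind => [|_ t [g [h [m [n [mg nh <- ->]]]]] IH].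
    by rewrite pairing_map0; apply: gcomp0 (cp_grading A') _.
  rewrite pairing_mapD; apply: (gcompD (cp_grading A')) => //.
  by rewrite pairing_mapE; apply: pairing_comp.
(* Here the [f_i] and [x_i] form a dual basis, for which [\sum_i (f_i, x_i) = 1]. *)
pose inv (a : A') : tens_bimodule D bP := \sum_(q <- s) btens (q.1 : D) (bm_r bP q.2 a).
have invD : {morph inv : a b / a + b}.
  move=> a b; rewrite -big_split; apply: eq_bigr => q _.
  by rewrite bm_rDr btensDr.
exists inv => [t|a].
  elim/btens_ind: t => [|f p t IH]; first by rewrite pairing_map0 (morph_add0 invD).
  rewrite pairing_mapD invD IH pairing_mapE; congr (_ + _).
  transitivity (btens (\sum_(q <- s) bm_r D (q.1 : D) ((f : lhom bP) q.2)) p).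
    rewrite btens_suml; apply: eq_bigr => q _.
    by rewrite pairingP -btens_bal.
  congr (btens _ p); apply: lhomP => m; rewrite lhom_suml {2}(hs m) lhom_sumr.
  by apply: eq_bigr => q _; rewrite lhomZ.
rewrite (morph_add_sum pairing_mapD).
under eq_bigr => q _ do rewrite pairing_mapE pairing_r.
rewrite -mulr_suml -[RHS]mul1r; congr (_ * a); apply: bp_ext => m.
rewrite bm_r_sumr bm_r1 [RHS]hs; apply: eq_bigr => q _.
exact: pairingP.
Qed.

Lemma progenerator_graded_morita : induce_graded_morita P.
Proof. by split; [apply: eval_giso|apply: pairing_giso]. Qed.

End GradedMorita.

(** * The induced bimodule *)

Section ComponentRight.
Variables (O : comNzRingType) (Q : finGroupType) (A : crossed_product O Q).

Lemma cp_proj_r k a m g : a \in cp_comp A k ->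
  gproj (cp_grading A) g (m * a) = gproj (cp_grading A) (g * k^-1)%g m * a.
Proof.
move=> ak; rewrite (@gproj_uniq _ _ _ _ _
  [ffun h => gproj (cp_grading A) (h * k^-1)%g m * a]) ?ffunE //.
split=> [h|].
  by rewrite ffunE -{2}(mulgKV k h) cp_compM // gproj_mem.
rewrite {1}(gproj_sum (cp_grading A) m) mulr_suml (reindex_inj (mulIg k^-1%g)) /=.
by apply: eq_bigr => h _; rewrite ffunE.
Qed.

End ComponentRight.

(** * The grading of the tensor product over [C] *)

Section CTensorGrading.
Variables (O : comNzRingType) (Q : finGroupType) (C : graded_acted_algebra O Q).
Variables A A' : cp_over C.
Let gA := cp_grading A.
Let gA' := cp_grading A'.
Local Notation T := (ctens A A').

Lemma co_map_comp (B : cp_over C) g c : c \in ga_comp C g -> co_map B c \in cp_comp B g.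
Proof. by case: (co_mapP B) => _ h _; apply: h. Qed.

Definition ctens_proj (x : Q) : T -> T := tlift (fun a a' =>
  \sum_g ct (gproj gA g a) (gproj gA' (g^-1 * x)%g a')).

(** It suffices to move a homogeneous [c] of degree [k] across the tensor sign; both structure maps
    preserve its degree, and the sum is reindexed by [g |-> g k]. *)
Lemma ctens_proj_bal x : balanced (fun (a : A) (c : C) => a * co_map A c)
  (fun (c : C) (a' : A') => co_map A' c * a') (fun a a' =>
  \sum_g ct (gproj gA g a) (gproj gA' (g^-1 * x)%g a')).
Proof.
split=> [a b a'|a a' b'|a c a'].
- by rewrite -big_split; apply: eq_bigr => g _; rewrite gprojD ctDl.
- by rewrite -big_split; apply: eq_bigr => g _; rewrite gprojD ctDr.
have gC : is_grading (ga_comp C) by case: (ga_graded C).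
apply: (hom_ext gC (F := fun c => \sum_g ct (gproj gA g (a * co_map A c))
    (gproj gA' (g^-1 * x)%g a')) (G := fun c => \sum_g ct (gproj gA g a)
    (gproj gA' (g^-1 * x)%g (co_map A' c * a')))) => [d e|d e|k d dk].
- rewrite -big_split; apply: eq_bigr => g _.
  by rewrite rmorphD mulrDr gprojD ctDl.
- rewrite -big_split; apply: eq_bigr => g _.
  by rewrite rmorphD mulrDl gprojD ctDr.
rewrite (reindex_inj (mulIg k)); apply: eq_bigr => g _ /=.
rewrite (cp_proj_r _ _ (co_map_comp A dk)) (cp_proj_l _ _ (co_map_comp A' dk)).
by rewrite mulgK invMg mulgA ct_bal.
Qed.

Lemma ctens_projE x a a' : ctens_proj x (ct a a') =
  \sum_g ct (gproj gA g a) (gproj gA' (g^-1 * x)%g a').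
Proof. exact: tliftE (ctens_proj_bal x) _ _. Qed.
Lemma ctens_projD x : {morph ctens_proj x : s t / s + t}.
Proof. exact: tliftD (ctens_proj_bal x). Qed.
Lemma ctens_proj0 x : ctens_proj x 0 = 0.
Proof. exact: tlift0 (ctens_proj_bal x). Qed.

Lemma ctens_proj_hom x y t : t \in Defs.span (@ctens_gen _ _ _ A A' y) ->
  ctens_proj x t = if x == y then t else 0.
Proof.
move: t; apply: Defs.span_ind => [|_ t [g [h [a [a' [ag ah <- ->]]]]] IH].
  by rewrite ctens_proj0 if_same.
rewrite ctens_projD IH ctens_projE (bigD1 g) //= big1 => [|k nk]; last first.
  by rewrite (gproj_hom gA _ ag) (negPf nk) ct0l.
rewrite (gproj_hom gA _ ag) eqxx (gproj_hom gA' _ ah) addr0.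
rewrite -(inj_eq (mulgI g)) mulKVg; case: eqP => // _.
by rewrite addr0 ct0r.
Qed.

Lemma ctens_proj_mem x t : ctens_proj x t \in Defs.span (@ctens_gen _ _ _ A A' x).
Proof.
elim/ct_ind: t => [|a a' t IH]; first by rewrite ctens_proj0; apply: Defs.span0.
rewrite ctens_projD Defs.spanD // ctens_projE.
elim/big_rec: _ => [|g s _ hs]; first exact: Defs.span0.
apply: Defs.spanD => //; apply: Defs.span_gen.
exists g, (g^-1 * x)%g, (gproj gA g a), (gproj gA' (g^-1 * x)%g a').
by rewrite !gproj_mem mulKVg.
Qed.

Lemma ctens_proj_sum t : t = \sum_x ctens_proj x t.
Proof.
elim/ct_ind: t => [|a a' t IH].
  by rewrite big1 // => x _; rewrite ctens_proj0.
under eq_bigr => x _ do rewrite ctens_projD ctens_projE.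
rewrite big_split /= -IH; congr (_ + _); rewrite exchange_big /=.
transitivity (\sum_g ct (gproj gA g a) a').
  by rewrite {1}(gproj_sum gA a) (morph_add_sum (fun u v => ctDl u v a')).
apply: eq_bigr => g _; rewrite {1}(gproj_sum gA' a') (reindex_inj (mulgI g^-1%g)).
exact: (morph_add_sum (ctDr (gproj gA g a))).
Qed.

(** Induction on the subtype itself, since only its elements act on [ctens] and on modules. *)
Lemma delta_ind (K : delta A A' -> Prop) : K 0 ->
  (forall (s t : delta A A') g a a', a \in cp_comp A g -> a' \in cp_comp A' g^-1%g ->
    \val s = ct a a' -> K t -> K (s + t)) -> forall s, K s.
Proof.
move=> K0 KD s.
have h t : t \in @delta_pred _ _ _ A A' -> forall s : delta A A', \val s = t -> K s.
  move: t {s}; apply: (@Defs.span_ind _ _ (fun t => forall s : delta A A', \val s = t -> K s)).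
    by move=> s hs; have -> : s = 0 by apply: val_inj.
  move=> _ t [g [a [a' [ag ag' ->]]]] IH s hs.
  have dp : ct a a' \in @delta_pred _ _ _ A A'.
    by apply: Defs.span_gen; exists g, a, a'.
  have -> : s = Delta dp + (s - Delta dp) by rewrite addrC subrK.
  by apply: (KD _ _ g a a') => //; apply: IH; rewrite /= hs addrC addKr.
exact: h (valP s) _ erefl.
Qed.

(** A generator of the diagonal algebra multiplies the two factors by elements of degrees [k] and
    [k^-1], which cancel in the total degree. Hence the projections descend to the induced
    bimodule. *)
Lemma ctens_proj_mul x t s :
  ctens_proj x (ctens_mul t s) = ctens_mul (ctens_proj x t) s.
Proof.
elim/ct_ind: t => [|a a' t IH]; first by rewrite !(ctens_mul0l, ctens_proj0).
rewrite ctens_mulDl !ctens_projD ctens_mulDl IH; congr (_ + _) => {t IH}.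
elim/delta_ind: s => [|s t k d d' dk dk' hs IH].
  have z u : @ctens_mul _ _ _ A A' u 0 = 0.
    by apply: (addrI (ctens_mul u 0)); rewrite -ctens_mulDr !addr0.
  by rewrite !z ctens_proj0.
rewrite !ctens_mulDr ctens_projD IH (ctens_mulE _ _ hs); congr (_ + _).
rewrite !ctens_projE (morph_add_sum (ctens_mulDl s)) (reindex_inj (mulIg k)).
apply: eq_bigr => g _ /=; rewrite (ctens_mulE _ _ hs).
rewrite (cp_proj_r _ _ dk) (cp_proj_l _ _ dk') mulgK invgK invMg.
by rewrite -mulgA mulKVg.
Qed.

Lemma ctens_l1 (t : T) : ctens_l 1 t = t.
Proof.
elim/ct_ind: t => [|a a' t IH]; first exact: ctens_l0.
by rewrite ctens_lDr IH ctens_lE mul1r.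
Qed.
Lemma ctens_r1 (t : T) : ctens_r t 1 = t.
Proof.
elim/ct_ind: t => [|a a' t IH]; first exact: ctens_r0.
by rewrite ctens_rDl IH ctens_rE mulr1.
Qed.
(** Both structure maps send the scalar [k] of [C] to the scalar [k], so balance over [C] moves it
    across. *)
Lemma ctens_A (k : O) (t : T) : ctens_l k%:A t = ctens_r t k%:A.
Proof.
elim/ct_ind: t => [|a a' t IH]; first by rewrite ctens_l0 ctens_r0.
rewrite ctens_lDr ctens_rDl IH ctens_lE ctens_rE; congr (_ + _).
have e (B : cp_over C) : co_map B k%:A = k%:A by rewrite linearZ /= rmorph1.
have := ct_bal a (k%:A : C) a'; rewrite !e.
by rewrite -!scalerAl -!scalerAr !mul1r !mulr1.
Qed.

Lemma ctens_comp1P (t : T) :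
  t \in Defs.span (@ctens_gen _ _ _ A A' 1%g) -> t \in @delta_pred _ _ _ A A'.
Proof.
move: t; apply: Defs.span_ind => [|_ t [g [h [a [a' [ag ah gh ->]]]]] IH].
  exact: Defs.span0.
apply: Defs.spanD => //; apply: Defs.span_gen; exists g, a, a'; split=> //.
by rewrite -(mulKg g h) gh mulg1 in ah.
Qed.

Lemma ctens_l_comp g x a (t : T) : a \in cp_comp A g ->
  t \in Defs.span (@ctens_gen _ _ _ A A' x) ->
  ctens_l a t \in Defs.span (@ctens_gen _ _ _ A A' (g * x)%g).
Proof.
move=> ag; move: t; apply: Defs.span_ind => [|_ t [h [k [d [d' [dh dk <- ->]]]]] IH].
  by rewrite ctens_l0 Defs.span0.
rewrite ctens_lDr Defs.spanD // ctens_lE; apply: Defs.span_gen.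
by exists (g * h)%g, k, (a * d), d'; rewrite cp_compM ?mulgA.
Qed.

Lemma ctens_r_comp g x a (t : T) : a \in cp_comp A' g ->
  t \in Defs.span (@ctens_gen _ _ _ A A' x) ->
  ctens_r t a \in Defs.span (@ctens_gen _ _ _ A A' (x * g)%g).
Proof.
move=> ag; move: t; apply: Defs.span_ind => [|_ t [h [k [d [d' [dh dk <- ->]]]]] IH].
  by rewrite ctens_r0 Defs.span0.
rewrite ctens_rDl Defs.spanD // ctens_rE; apply: Defs.span_gen.
by exists h, (k * g)%g, d, (d' * a); rewrite cp_compM ?mulgA.
Qed.

Lemma ctens_gC g c (t : T) : t \in Defs.span (@ctens_gen _ _ _ A A' g) ->
  ctens_r t (co_map A' c) = ctens_l (co_map A (ga_act C g c)) t.
Proof.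
move: t; apply: Defs.span_ind => [|_ t [h [k [d [d' [dh dk <- ->]]]]] IH].
  by rewrite ctens_r0 ctens_l0.
rewrite ctens_rDl ctens_lDr IH ctens_rE ctens_lE; congr (_ + _).
rewrite ga_actM (co_commute _ (co_mapP A') dk).
by rewrite -(co_commute _ (co_mapP A) dh) ct_bal.
Qed.

End CTensorGrading.

(** * Grading of the induced bimodule and its degree one component *)

Section InducedBimodule.
Variables (O : comNzRingType) (Q : finGroupType) (C : graded_acted_algebra O Q).
Variables A A' : cp_over C.

Section Module.
Variables (M : zmodType) (act : delta A A' -> M -> M).
Local Notation I := (icar act).
Local Notation it := (@itens _ _ _ A A' M act).

Lemma itensDl s t m : it (s + t) m = it s m + it t m.
Proof. exact: tensDl. Qed.
Lemma itensDr t m n : it t (m + n) = it t m + it t n.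
Proof. exact: tensDr. Qed.
Lemma itens0l m : it 0 m = 0. Proof. exact: tens0l. Qed.
Lemma itens0r t : it t 0 = 0. Proof. exact: tens0r. Qed.
Lemma itens_bal t s m : it (ctens_mul t s) m = it t (act s m).
Proof. exact: tens_bal. Qed.
Lemma itens_ind (K : I -> Prop) :
  K 0 -> (forall t m z, K z -> K (it t m + z)) -> forall z, K z.
Proof. exact: tens_ind. Qed.
Lemma induced_lD x : {morph induced_l (act := act) x : z w / z + w}.
Proof. exact: tliftD (induced_l_bal act x). Qed.
Lemma induced_rD y : {morph (fun z : I => induced_r z y) : z w / z + w}.
Proof. exact: tliftD (induced_r_bal act y). Qed.
Lemma induced_l0 x : induced_l x (0 : I) = 0.
Proof. exact: tlift0 (induced_l_bal act x). Qed.
Lemma induced_r0 y : induced_r (0 : I) y = 0.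
Proof. exact: tlift0 (induced_r_bal act y). Qed.

Fact induced_bimodule :
  is_bimodule (@induced_l _ _ _ A A' M act) (@induced_r _ _ _ A A' M act).
Proof.
split; first split.
- elim/itens_ind => [|t m z IH]; first exact: induced_l0.
  by rewrite induced_lD IH induced_lE ctens_l1.
- move=> a b; elim/itens_ind => [|t m z IH]; first by rewrite !induced_l0.
  by rewrite !induced_lD IH !induced_lE ctens_lM.
- exact: induced_lD.
- move=> a b; elim/itens_ind => [|t m z IH]; first by rewrite !induced_l0 addr0.
  by rewrite !induced_lD IH !induced_lE ctens_lDl itensDl addrACA.
- split.
  + elim/itens_ind => [|t m z IH]; first exact: induced_r0.
    by rewrite induced_rD IH induced_rE ctens_r1.
  + move=> a b; elim/itens_ind => [|t m z IH]; first by rewrite !induced_r0.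
    by rewrite !induced_rD IH !induced_rE ctens_rM.
  + by move=> *; apply: induced_rD.
  + move=> a b; elim/itens_ind => [|t m z IH]; first by rewrite !induced_r0 addr0.
    by rewrite !induced_rD IH !induced_rE ctens_rDr itensDl addrACA.
- move=> a z b; elim/itens_ind: z => [|t m z IH].
    by rewrite !(induced_l0, induced_r0).
  by rewrite !(induced_lD, induced_rD) IH !(induced_lE, induced_rE) ctens_lr.
- move=> k; elim/itens_ind => [|t m z IH]; first by rewrite induced_l0 induced_r0.
  by rewrite induced_lD induced_rD IH induced_lE induced_rE ctens_A.
Qed.

Definition iproj (x : Q) : I -> I := tlift (fun t m => it (ctens_proj x t) m).
Lemma iproj_bal x :
  balanced (@ctens_mul _ _ _ A A') act (fun t m => it (ctens_proj x t) m).
Proof.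
split=> *; first by rewrite ctens_projD itensDl.
- by rewrite itensDr.
- by rewrite ctens_proj_mul itens_bal.
Qed.
Lemma iprojE x t m : iproj x (it t m) = it (ctens_proj x t) m.
Proof. exact: tliftE (iproj_bal x) _ _. Qed.
Lemma iprojD x : {morph iproj x : z w / z + w}.
Proof. exact: tliftD (iproj_bal x). Qed.
Lemma iproj0 x : iproj x 0 = 0.
Proof. exact: tlift0 (iproj_bal x). Qed.

Lemma iproj_hom x y z : z \in Defs.span (@induced_gen _ _ _ A A' M act y) ->
  iproj x z = if x == y then z else 0.
Proof.
move: z; apply: Defs.span_ind => [|_ z [t [m [ty ->]]] IH].
  by rewrite iproj0 if_same.
rewrite iprojD IH iprojE (ctens_proj_hom _ ty); case: eqP => // _.
by rewrite itens0l addr0.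
Qed.

Lemma iproj_mem x z : iproj x z \in Defs.span (@induced_gen _ _ _ A A' M act x).
Proof.
elim/itens_ind: z => [|t m z IH]; first by rewrite iproj0; apply: Defs.span0.
rewrite iprojD Defs.spanD // iprojE; apply: Defs.span_gen.
by exists (ctens_proj x t), m; split=> //; apply: ctens_proj_mem.
Qed.

Lemma iproj_sum z : z = \sum_x iproj x z.
Proof.
elim/itens_ind: z => [|t m z IH].
  by rewrite big1 // => x _; rewrite iproj0.
under eq_bigr => x _ do rewrite iprojD iprojE.
rewrite big_split /= -IH -(morph_add_sum (fun u v => itensDl u v m)).
by rewrite -ctens_proj_sum.
Qed.

Lemma ctens_gen_zmod (x : Q) : zmod_closed (Defs.span (@ctens_gen _ _ _ A A' x)).
Proof.
apply: Defs.span_zmod => _ [g [h [a [a' [ag ah e ->]]]]].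
by exists g, h, (- a), a'; rewrite (gcompN (cp_grading A)) // ctNl.
Qed.

Fact induced_proof : is_gbimodule (induced act).
Proof.
split=> [||g x h a z a' ag zx ah|x z c zx].
- exact: induced_bimodule.
- split=> [x|z].
    apply: Defs.span_zmod => _ [t [m [tx ->]]]; exists (- t), m; split.
      have [z0 zB] := ctens_gen_zmod x.
      by rewrite -[- t]add0r; apply: zB.
    by rewrite (morph_addN (fun u v => itensDl u v m)).
  exists [ffun x => iproj x z]; split=> [|F [hF ->]].
    split=> [x|]; first by rewrite ffunE; apply: iproj_mem.
    by rewrite {1}[z]iproj_sum; apply: eq_bigr => x _; rewrite ffunE.
  apply/ffunP => x; rewrite ffunE (morph_add_sum (iprojD x)) (bigD1 x) //= big1.
    by rewrite (iproj_hom _ (hF x)) eqxx addr0.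
  by move=> y nyx; rewrite (iproj_hom _ (hF y)) eq_sym (negPf nyx).
- move: z zx; rewrite /=; apply: Defs.span_ind => [|_ z [t [m [tx ->]]] IH].
    by rewrite induced_l0 induced_r0 Defs.span0.
  rewrite induced_lD induced_rD Defs.spanD // induced_lE induced_rE; apply: Defs.span_gen.
  exists (ctens_r (ctens_l a t) a'), m; split=> //.
  by apply: ctens_r_comp ah _; apply: ctens_l_comp.
- move: z zx; rewrite /=; apply: Defs.span_ind => [|_ z [t [m [tx ->]]] IH].
    by rewrite induced_l0 induced_r0.
  rewrite induced_rD induced_lD IH induced_rE induced_lE.
  by rewrite (ctens_gC _ tx).
Qed.

Definition ginduced : gbimodule A A' := GBimodule induced_proof.

Hypothesis act_mod : is_lmodule act.

Fact ctens_proj1_delta (t : ctens A A') : ctens_proj 1%g t \in @delta_pred _ _ _ A A'.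
Proof. by apply: ctens_comp1P; apply: ctens_proj_mem. Qed.
Definition delta_proj t : delta A A' := Delta (ctens_proj1_delta t).

(** A left inverse of [m |-> (1 (x) 1) (x) m], which proves that [M] embeds in the induced bimodule.
    It is well defined because the projection onto the diagonal algebra is linear for its right
    action. *)
Definition delta_act : I -> M := tlift (fun t m => act (delta_proj t) m).
Lemma delta_act_bal :
  balanced (@ctens_mul _ _ _ A A') act (fun t m => act (delta_proj t) m).
Proof.
have [a1 aM aDr aDl] := act_mod.
split=> [s t m|t m n|t s m].
- by rewrite -aDl; congr (act _ m); apply: val_inj; rewrite /= ctens_projD.
- by rewrite aDr.
- by rewrite -aM; congr (act _ m); apply: val_inj; rewrite /= ctens_proj_mul.
Qed.

Lemma ct11_comp : ct 1 1 \in Defs.span (@ctens_gen _ _ _ A A' 1%g).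
Proof.
by apply: Defs.span_gen; exists 1%g, 1%g, 1, 1; rewrite !cp_comp1 mulg1.
Qed.

Lemma delta_act_one m : delta_act (it (ct 1 1) m) = m.
Proof.
have [a1 _ _ _] := act_mod.
rewrite [LHS](tliftE delta_act_bal) -[RHS]a1; congr (act _ m); apply: val_inj.
by rewrite /= (ctens_proj_hom _ ct11_comp) eqxx.
Qed.

Lemma itens_one s m : it (ct 1 1) (act s m) = it (\val s) m.
Proof. by rewrite -itens_bal ctens_mulC ctens_l1 ctens_r1. Qed.

End Module.

Lemma induced_degree_one_part (M : bimodule (idcomp A) (idcomp A'))
    (act : delta A A' -> M -> M) : extends_bimodule act ->
  @degree_one_part _ _ C A A' (ginduced act) M (itens act (ct 1 1)).
Proof.
move=> [act_mod act_ext].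
have key (x : idcomp A) (y : idcomp A') m : itens act (ct 1 1) (bm_r M (bm_l M x m) y) =
    itens act (ct (\val x) (\val y)) m.
  have dp : ct (\val x) (\val y) \in @delta_pred _ _ _ A A'.
    apply: Defs.span_gen; exists 1%g, (\val x), (\val y).
    by rewrite invg1; split=> //; [exact: (valP x)|exact: (valP y)].
  by rewrite -(act_ext (Delta dp)) // itens_one.
split=> [m n|m h|m|z|x m|m y].
- exact: itensDr.
- rewrite -(delta_act_one act_mod m) h.
  exact: (tlift0 (delta_act_bal act_mod)).
- by apply: Defs.span_gen; exists (ct 1 1), m; split=> //; apply: ct11_comp.
- move: z; apply: Defs.span_ind => [|_ z [t [m [t1 ->]]] [n <-]].
    by exists 0; rewrite itens0r.
  (* In degree one, [t] lies in the diagonal algebra and moves across: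
     [t (x) m = (1 (x) 1) (x) t m]. *)
  exists (act (Delta (ctens_comp1P t1)) m + n).
  by rewrite itensDr itens_one.
- rewrite -[bm_l M x m](@bm_r1 _ _ _ M) key [RHS]induced_lE ctens_lE.
  by rewrite mulr1.
- by rewrite -[m in bm_r M m y](@bm_l1 _ _ _ M) key [RHS]induced_rE ctens_rE mul1r.
Qed.

End InducedBimodule.

(** * The action of the diagonal algebra in degree one *)

Section TwoSidedAction.
Variables (O : comNzRingType) (Q : finGroupType) (C : graded_acted_algebra O Q).
Variables (A A' : cp_over C) (P : gbimodule A A').
Implicit Types (p q : P) (t : ctens A A').

(* [(a (x) a') p = a p a'], meaningful for [p] of degree one, which commutes
   with [C]. *)
Definition two_sided t p : P := tlift (fun a a' => gd_r (gd_l a p) a') t.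

Section DegreeOneElement.
Variable p : P.
Hypothesis p1 : p \in gd_comp P 1%g.

Lemma two_sided_bal : balanced (fun (a : A) (c : C) => a * co_map A c)
  (fun (c : C) (a' : A') => co_map A' c * a') (fun a a' => gd_r (gd_l a p) a').
Proof.
split=> [a b a'|a a' b'|a c a'].
- by rewrite gb_lDl gb_rDl.
- by rewrite gb_rDr.
- by rewrite gb_lM gb_rM [gd_r (gd_l a p) _]gb_lr (gb_C c p1) ga_act1.
Qed.

Lemma two_sidedE a a' : two_sided (ct a a') p = gd_r (gd_l a p) a'.
Proof. exact: tliftE two_sided_bal _ _. Qed.
Lemma two_sidedDl : {morph two_sided^~ p : s t / s + t}.
Proof. exact: tliftD two_sided_bal. Qed.
Lemma two_sided0l : two_sided 0 p = 0.
Proof. exact: tlift0 two_sided_bal. Qed.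

Lemma two_sided_l a t : two_sided (ctens_l a t) p = gd_l a (two_sided t p).
Proof.
elim/ct_ind: t => [|d d' t IH]; first by rewrite ctens_l0 two_sided0l gb_l0.
rewrite ctens_lDr !two_sidedDl gb_lDr IH ctens_lE !two_sidedE.
by rewrite gb_lM gb_lr.
Qed.

Lemma two_sided_r a t : two_sided (ctens_r t a) p = gd_r (two_sided t p) a.
Proof.
elim/ct_ind: t => [|d d' t IH]; first by rewrite ctens_r0 two_sided0l gb_r0.
by rewrite ctens_rDl !two_sidedDl gb_rDl IH ctens_rE !two_sidedE gb_rM.
Qed.

Lemma two_sided_comp x t : t \in gd_comp (ctens_data A A') x ->
  two_sided t p \in gd_comp P x.
Proof.
move: t; apply: Defs.span_ind => [|_ t [g [h [a [a' [ag ah <- ->]]]]] IH].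
  by rewrite two_sided0l (gcomp0 (gb_grading P)).
rewrite two_sidedDl (gcompD (gb_grading P)) // two_sidedE.
by apply: gb_comp_r ah _; rewrite -[g]mulg1; apply: gb_comp_l.
Qed.

Lemma two_sided_delta (s : delta A A') : two_sided (\val s) p \in gd_comp P 1%g.
Proof.
apply: two_sided_comp; move: (\val s) (valP s).
apply: Defs.span_ind => [|_ t [g [a [a' [ag ag' ->]]]] IH]; first exact: Defs.span0.
apply: Defs.spanD => //; apply: Defs.span_gen; exists g, g^-1%g, a, a'.
by rewrite mulgV.
Qed.

End DegreeOneElement.

(** For [t] in the diagonal algebra this is associativity of the action; for general [t] it makes
    [induced_map] balanced. *)
Lemma two_sided_mul p t (s : delta A A') : p \in gd_comp P 1%g ->
  two_sided (ctens_mul t s) p = two_sided t (two_sided (\val s) p).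
Proof.
move=> p1; have sp1 := two_sided_delta p1 s.
elim/ct_ind: t => [|a a' t IH]; first by rewrite ctens_mul0l !two_sided0l.
rewrite ctens_mulDl !two_sidedDl // IH; congr (_ + _).
by rewrite ctens_mulC two_sided_r // two_sided_l // two_sidedE.
Qed.

Lemma two_sidedDr p q t : p \in gd_comp P 1%g -> q \in gd_comp P 1%g ->
  two_sided t (p + q) = two_sided t p + two_sided t q.
Proof.
move=> p1 q1; have pq1 := gcompD (gb_grading P) p1 q1.
elim/ct_ind: t => [|a a' t IH]; first by rewrite !two_sided0l ?addr0.
rewrite !two_sidedDl // IH !two_sidedE // gb_lDr gb_rDl.
exact: addrACA.
Qed.

Variables (M : bimodule (idcomp A) (idcomp A')) (j : M -> P).
Hypothesis jP : degree_one_part j.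

Definition degree_one_act (s : delta A A') (m : M) : M :=
  d1_inv j (two_sided (\val s) (j m)).

Lemma degree_one_actE s m : j (degree_one_act s m) = two_sided (\val s) (j m).
Proof. by rewrite d1_invK // two_sided_delta // (d1_mem jP). Qed.

Lemma degree_one_act_extends : extends_bimodule degree_one_act.
Proof.
have jm := d1_mem jP; split; first split.
- move=> m; apply: (d1_inj jP); rewrite degree_one_actE two_sidedE //.
  by rewrite gb_l1 gb_r1.
- move=> s t m; apply: (d1_inj jP); rewrite !degree_one_actE.
  exact: two_sided_mul.
- move=> s m n; apply: (d1_inj jP).
  by rewrite (d1_D jP) !degree_one_actE (d1_D jP) two_sidedDr.
- move=> s t m; apply: (d1_inj jP).
  by rewrite (d1_D jP) !degree_one_actE two_sidedDl.
- move=> s x y m hs; apply: (d1_inj jP).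
  by rewrite degree_one_actE hs two_sidedE // (d1_r jP) (d1_l jP).
Qed.

Section InducedIsomorphism.
Variable act : delta A A' -> M -> M.
Hypothesis act_ext : extends_bimodule act.
Hypothesis actE : forall s m, j (act s m) = two_sided (\val s) (j m).

Definition induced_map : icar act -> P := tlift (fun t m => two_sided t (j m)).

Lemma induced_map_bal :
  balanced (@ctens_mul _ _ _ A A') act (fun t m => two_sided t (j m)).
Proof.
have jm := d1_mem jP; split=> [s t m|t m n|t s m].
- by rewrite two_sidedDl.
- by rewrite (d1_D jP) two_sidedDr.
- by rewrite two_sided_mul // actE.
Qed.
Lemma induced_mapE t m : induced_map (itens act t m) = two_sided t (j m).
Proof. exact: tliftE induced_map_bal _ _. Qed.
Lemma induced_mapD : {morph induced_map : z w / z + w}.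
Proof. exact: tliftD induced_map_bal. Qed.
Lemma induced_map0 : induced_map 0 = 0.
Proof. exact: tlift0 induced_map_bal. Qed.

(** The map [t (x) m |-> t j(m)] restricts in degree one to the identification of both components
    with [M], so [giso_of_degree_one] applies: [P] is induced from its degree one component. *)
Lemma induced_giso : giso (ginduced act) P.
Proof.
have jm := d1_mem jP; have iP := induced_degree_one_part act_ext.
have map1 m : induced_map (itens act (ct 1 1) m) = j m.
  by rewrite induced_mapE two_sidedE // gb_l1 gb_r1.
apply: (@giso_of_degree_one _ _ _ _ _ (ginduced act) P induced_map).
- exact: induced_mapD.
- move=> a; rewrite /=; elim/itens_ind => [|t m z IH].
    by rewrite induced_l0 induced_map0 gb_l0.
  rewrite induced_lD !induced_mapD gb_lDr IH induced_lE !induced_mapE.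
  by rewrite two_sided_l.
- move=> z a; rewrite /=; elim/itens_ind: z => [|t m z IH].
    by rewrite induced_r0 induced_map0 gb_r0.
  rewrite induced_rD !induced_mapD gb_rDl IH induced_rE !induced_mapE.
  by rewrite two_sided_r.
- move=> x; apply: Defs.span_ind => [|_ z [t [m [tx ->]]] IH].
    by rewrite induced_map0 (gcomp0 (gb_grading P)).
  rewrite induced_mapD (gcompD (gb_grading P)) // induced_mapE.
  exact: two_sided_comp.
- move=> z z1; have [m <-] := d1_surj iP z1.
  by rewrite map1 => /(d1_eq0 jP) ->; apply: itens0r.
- by move=> p p1; have [m <-] := d1_surj jP p1; exists (itens act (ct 1 1) m).
Qed.

End InducedIsomorphism.
End TwoSidedAction.

(** The given action on [M] is recovered from the two-sided action inside the induced bimodule,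
    where formulas can be computed. *)
Lemma induced_actE (O : comNzRingType) (Q : finGroupType)
    (C : graded_acted_algebra O Q) (A A' : cp_over C)
    (M : bimodule (idcomp A) (idcomp A')) (act : delta A A' -> M -> M) s m :
  extends_bimodule act -> itens act (ct 1 1) (act s m) =
  two_sided (P := ginduced act) (\val s) (itens act (ct 1 1) m).
Proof.
move=> act_ext; have jm := d1_mem (induced_degree_one_part act_ext) m.
rewrite itens_one; elim/ct_ind: (\val s) => [|a a' t IH].
  by rewrite two_sided0l ?itens0l.
rewrite two_sidedDl // itensDl IH; congr (_ + _); rewrite two_sidedE //.
by rewrite /= induced_lE induced_rE ctens_lE ctens_rE mulr1 mul1r.
Qed.

(** * The dual of the induced bimodule and the conclusion *)

Section ExtendedDual.
Variables (O : comNzRingType) (Q : finGroupType) (C : graded_acted_algebra O Q).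
Variables (A A' : cp_over C) (M : bimodule (idcomp A) (idcomp A')).
Variable act : delta A A' -> M -> M.
Hypothesis act_ext : extends_bimodule act.

Let iP := induced_degree_one_part act_ext.
Let dP := dual_degree_one_part iP.

(** Transported from the degree one component of the graded dual instead of defined by the explicit
    formula, so the module axioms and independence of the units come for free. *)
Definition dual_act : delta A' A -> dual M -> dual M :=
  degree_one_act (P := gdual (ginduced act)) (M := dual M) (fun f => d1_lift iP f).

Lemma dual_act_extends : @extends_bimodule _ _ C A' A (dual M) dual_act.
Proof. exact: degree_one_act_extends dP. Qed.

(** Let [F] extend [f] to the induced bimodule and let [x] be the image of [m]. The left side is
    [F(x a') a], while [x a'] may leave degree one; [v x a'] lies in degree one, and
    [u F(v x a') = F(x a')] as [F] is linear over [A]. *)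
Lemma dual_act_formula : dual_action_formula act dual_act.
Proof.
move=> g a' a u v s d a'g ag ug uv vu hs hd f m.
rewrite -(d1_liftE iP) [X in lhom_fun X](degree_one_actE dP s f) hs.
rewrite two_sidedE; last exact: (d1_mem dP).
rewrite -(d1_liftE iP f) induced_actE // hd two_sidedE; last exact: (d1_mem iP).
set F := d1_lift iP f; pose x : ginduced act := itens act (ct 1 1) m; rewrite -/x.
transitivity (F (gd_r x a') * a) => //.
by rewrite gb_lr (gb_lhomZ F) mulrA uv mul1r.
Qed.

(** An instance of [induced_giso] with the graded dual as [P], its degree one component being
    [dual M]. *)
Lemma dual_induced_giso : giso (gdual (ginduced act)) (ginduced dual_act).
Proof.
apply: giso_sym; apply: (induced_giso dP dual_act_extends) => s f.
exact: degree_one_actE dP s f.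
Qed.

Lemma induced_graded_morita :
  induce_morita M (dual M) -> induce_graded_morita (ginduced act).
Proof.
move=> hM; apply: progenerator_graded_morita.
exact: degree_one_progenerator iP (morita_progenerator hM).
Qed.

End ExtendedDual.

Theorem theorem3p3
  (p : nat) (O : idomainType) (K : fieldType) (k : closedFieldType)
  (iota : {rmorphism O -> K}) (res : {rmorphism O -> k})
  (hpms : p_modular_system p iota res)
  (gT : finGroupType) (hK : contains_roots_of_unity K #|[set: gT]|)
  (N G' : {group gT}) (nN : (N <| [set: gT])%g) (hG' : (G' * N)%g = [set: gT])
  (b : inv_block O [set: gT]%G N) (b' : inv_block O G' (G' :&: N)%G) :
  let bOG := block_crossed_product nN (setT_mulg N) (subxx N) b in
  let bOG' := block_crossed_product nN hG' (subsetIr G' N) b' in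
  forall (C : graded_acted_algebra O (coset_of N))
    (zeta : {lrmorphism C -> bOG}) (zeta' : {lrmorphism C -> bOG'})
    (hzeta : is_structure_map zeta) (hzeta' : is_structure_map zeta'),
  let A : cp_over C := CPOver hzeta in
  let A' : cp_over C := CPOver hzeta' in
  forall M : bimodule (idcomp A) (idcomp A'),
  induce_morita M (dual M) ->
  forall act : delta A A' -> M -> M,
  extends_bimodule act ->
  exists act' : delta A' A -> dual M -> dual M,
    [/\ @extends_bimodule _ _ C A' A (dual M) act',
        dual_action_formula act act'
      & exists (hM : is_gbimodule (induced act)) (hD : is_gbimodule (induced act')),
          let Mt := GBimodule hM in
          giso (gdual Mt) (GBimodule hD) /\ induce_graded_morita Mt].
Proof.
move=> bOG bOG' C zeta zeta' hzeta hzeta' A A' M hM act act_ext.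
exists (dual_act act_ext); split.
- exact: dual_act_extends.
- exact: dual_act_formula.
exists (induced_proof act), (induced_proof (dual_act act_ext)); split.
- exact: dual_induced_giso.
- exact: induced_graded_morita act_ext hM.
Qed.
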